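(* There is an algorithm that, given a finitely generated subgroup $H\le F_n$ and an element $g\in F_n$ that depends on $H$, does the following, where $D_g=\{d\in\mathbb N : \mathfrak I_g \text{ contains a non-trivial equation of degree } d\}$: (a) it determines which of the following two possibilities (exactly one of which takes place) holds: (i) $D_g$ contains an odd number and $\mathbb N\setminus D_g$ is finite; (ii) $D_g$ contains only even numbers and $2\mathbb N\setminus D_g$ is finite; (b) it computes the finite set $\mathbb N\setminus D_g$ in case (i), respectively the finite set $2\mathbb N\setminus D_g$ in case (ii).
   Context: $\mathbb N=\{0,1,2,\dots\}$ and $2\mathbb N$ is the set of non-negative even numbers. $F_n$ is the free group with basis $a_1,\dots,a_n$. For a finitely generated subgroup $H\le F_n$ let $\langle x\rangle\cong\mathbb Z$ be infinite cyclic. An equation with coefficients in $H$ is an element $w\in H*\langle x\rangle$; it has a unique expression as a reduced word in the alphabet $\{x,x^{-1}\}\cup (H\setminus\{1\})$. The degree of $w$ is the number of occurrences of $x$ and $x^{-1}$ in the cyclic reduction of $w$. For $g\in F_n$ let $\varphi_g:H*\langle x\rangle\to F_n$ be the homomorphism that is the inclusion on $H$ and sends $x$ to $g$, and let $\mathfrak I_g=\ker\varphi_g$, a normal subgroup of $H*\langle x\rangle$. We say $g$ depends on $H$ if $\mathfrak I_g$ is non-trivial. When an algorithm takes a finitely generated subgroup $H\le F_n$ as input, $H$ is given by a finite set of generators, each given as a word in the basis $a_1,\dots,a_n$. *)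

(* Defs.v *)
From HB Require Import structures.
From mathcomp Require Import all_boot.
From mathcomp Require Import boolp classical_sets cardinality.

Set Implicit Arguments.
Unset Strict Implicit.
Unset Printing Implicit Defensive.

Local Open Scope group_scope.
Local Open Scope classical_set_scope.

Lemma left_inverse_right (G : Type) (e : G) (inv : G -> G) (mul : G -> G -> G) :
  associative mul -> left_id e mul -> left_inverse e inv mul ->
  right_inverse e inv mul.
Proof.
move=> A E V x; rewrite -[LHS]E -(V (inv x)) -A [mul (inv x) _]A V E.
by rewrite V.
Qed.

Section FreeGroup.
Variable n : nat.

(* (i, true) is the basis element a_i and (i, false) is its inverse. *)
Definition letter : Type := ('I_n * bool)%type.

Implicit Types (a b : letter) (s t u : seq letter).

Definition letter_inv a : letter := (a.1, ~~ a.2).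

Definition free_reduced s := sorted (fun a b => b != letter_inv a) s.

Definition free_push a s :=
  if s is b :: s' then if b == letter_inv a then s' else a :: s else [:: a].

Definition free_mul s t := foldr free_push t s.

Definition free_inv s := rev (map letter_inv s).

Lemma letter_invK : involutive letter_inv.
Proof. by case=> i b; rewrite /letter_inv /= negbK. Qed.

Lemma free_push_reduced a s : free_reduced s -> free_reduced (free_push a s).
Proof.
case: s => [|b s] //= bs; case: eqP => [_|/eqP ab]; first exact: path_sorted bs.
by rewrite /free_reduced /= ab.
Qed.

Lemma free_mul_reduced s t : free_reduced t -> free_reduced (free_mul s t).
Proof. by move=> rt; elim: s => //= a s; exact: free_push_reduced. Qed.

Lemma free_pushK a s : free_reduced s ->
  free_push a (free_push (letter_inv a) s) = s.
Proof.
case: s => [|b s] /= bs; first by rewrite eqxx.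
rewrite letter_invK; case: eqP => [<-|_] /=; last by rewrite eqxx.
by case: s bs => [|c s] //= /andP[/negbTE-> _].
Qed.

Lemma free_mul_push a s t : free_reduced t ->
  free_mul (free_push a s) t = free_push a (free_mul s t).
Proof.
move=> rt; case: s => [|b s] //=; case: eqP => [->|_] //=.
by rewrite free_pushK // free_mul_reduced.
Qed.

Lemma free_mulA s t u : free_reduced u ->
  free_mul s (free_mul t u) = free_mul (free_mul s t) u.
Proof. by move=> ru; elim: s => //= a s ->; rewrite free_mul_push. Qed.

Lemma free_muls0 s : free_reduced s -> free_mul s [::] = s.
Proof.
elim: s => //= a s IH rs; rewrite (IH (path_sorted rs)).
by case: s rs {IH} => [|b s] //= /andP[/negbTE-> _].
Qed.

Lemma free_inv_reduced s : free_reduced s -> free_reduced (free_inv s).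
Proof.
rewrite /free_reduced /free_inv rev_sorted sorted_map.
by apply: sub_sorted => a b /=; rewrite letter_invK eq_sym.
Qed.

Lemma free_mulVs s : free_mul (free_inv s) s = [::].
Proof.
elim: s => //= a s IH.
by rewrite /free_inv /= rev_cons /free_mul foldr_rcons /= letter_invK eqxx.
Qed.

Record free_group :=
  FreeGroup { free_val :> seq letter; free_valP : free_reduced free_val }.

HB.instance Definition _ := [isSub for free_val].
HB.instance Definition _ := [Choice of free_group by <:].

Definition free_group_one := @FreeGroup [::] isT.
Definition free_group_mul (s t : free_group) :=
  FreeGroup (free_mul_reduced s (free_valP t)).
Definition free_group_inv (s : free_group) :=
  FreeGroup (free_inv_reduced (free_valP s)).

Lemma free_group_mulA : associative free_group_mul.
Proof. by move=> s t u; apply: val_inj; rewrite /= free_mulA ?free_valP. Qed.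
Lemma free_group_mul1 : left_id free_group_one free_group_mul.
Proof. by move=> s; apply: val_inj. Qed.
Lemma free_group_muls1 : right_id free_group_one free_group_mul.
Proof. by move=> s; apply: val_inj; rewrite /= free_muls0 ?free_valP. Qed.
Lemma free_group_mulV :
  left_inverse free_group_one free_group_inv free_group_mul.
Proof. by move=> s; apply: val_inj; rewrite /= free_mulVs. Qed.

End FreeGroup.

HB.instance Definition _ n := isGroup.Build (free_group n)
  (@free_group_mulA n) (@free_group_mul1 n) (@free_group_muls1 n)
  (@free_group_mulV n)
  (left_inverse_right (@free_group_mulA n) (@free_group_mul1 n)
     (@free_group_mulV n)).

Definition free_letter n (a : letter n) : free_group n :=
  @FreeGroup n [:: a] isT.

(* The element represented by an arbitrary, possibly non-reduced, word. *)
Definition free_word n (s : seq (letter n)) : free_group n :=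
  \prod_(a <- s) free_letter a.

Section GeneratedSubgroup.
Variables (G : groupType) (S : set G).

Definition generated : set G :=
  smallest (fun A : set G => group_closed (mem A)) S.

Lemma generated_closed : group_closed (mem generated).
Proof.
split=> [|u v]; rewrite ?inE => /=.
  by move=> A [[A1 _] _]; rewrite inE in A1.
move=> uS vS A AS; have [[_ AF] _] := AS.
by have := AF u v; rewrite !inE; apply; [exact: uS|exact: vS].
Qed.

Definition gen_group : Type := {h : G | h \in generated}.

HB.instance Definition _ := SubChoice.on gen_group.
HB.instance Definition _ :=
  SubChoice_isSubGroup.Build G (mem generated) gen_group generated_closed.

End GeneratedSubgroup.

Section Equations.
Variable H : groupType.

(* inl h is the letter h, inr true is x and inr false is its inverse. *)
Definition eqn_letter : Type := (H + bool)%type.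

Implicit Types (a b c : eqn_letter) (s t u : seq eqn_letter).

Definition interact a b :=
  match a, b with
  | inl _, inl _ => true
  | inr d, inr e => d != e
  | _, _ => false
  end.

Definition eqn_reduced s :=
  (inl 1 \notin s) && sorted (fun a b => ~~ interact a b) s.

Definition eqn_cons h s := if h == 1 then s else inl h :: s.

Definition eqn_push a s :=
  match a, s with
  | inl h, inl k :: s' => eqn_cons (h * k) s'
  | inl h, _ => eqn_cons h s
  | inr d, inr e :: s' => if d != e then s' else a :: s
  | inr d, _ => a :: s
  end.

Definition eqn_mulw s t := foldr eqn_push t s.

Definition eqn_letter_inv a : eqn_letter :=
  match a with inl h => inl h^-1 | inr e => inr (~~ e) end.

Definition eqn_invw s := rev (map eqn_letter_inv s).

Lemma eqn_reduced_cons a s : eqn_reduced (a :: s) =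
  [&& a != inl 1, if s is b :: _ then ~~ interact a b else true &
      eqn_reduced s].
Proof.
rewrite /eqn_reduced inE negb_or eq_sym.
by case: s => [|b s] /=; case: (a != _); rewrite //= andbCA.
Qed.

Lemma eqn_push_reduced a s : eqn_reduced s -> eqn_reduced (eqn_push a s).
Proof.
case: a => [h|d]; case: s => [|[k|e] s] //=; rewrite /eqn_cons.
- by case: eqP => // /eqP h1; rewrite eqn_reduced_cons h1.
- rewrite eqn_reduced_cons => /and3P[_ ks rs].
  by case: eqP => // /eqP hk; rewrite eqn_reduced_cons hk rs andbT;
    case: s ks {rs}.
- by case: eqP => // /eqP h1 rs; rewrite eqn_reduced_cons h1.
- case: ifPn => [_|de]; rewrite eqn_reduced_cons; first by case/and3P.
  by move=> rs; move: rs; rewrite !eqn_reduced_cons /= de.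
Qed.

Lemma eqn_mulw_reduced s t : eqn_reduced t -> eqn_reduced (eqn_mulw s t).
Proof. by move=> rt; elim: s => //= a s; exact: eqn_push_reduced. Qed.

Lemma eqn_push_x d s : eqn_reduced s ->
  eqn_push (inr d) (eqn_push (inr (~~ d)) s) = s.
Proof.
case: s => [|[k|e] s]; [by case: d|by case: d|].
rewrite eqn_reduced_cons => /and3P[_ + _].
by case: d e => [] []; case: s => [|[?|[]] ?].
Qed.

Lemma eqn_push_h h k s : eqn_reduced s ->
  eqn_push (inl h) (eqn_push (inl k) s) = eqn_push (inl (h * k)) s.
Proof.
have C (l m : H) t : (if t is inl _ :: _ then false else true) ->
    eqn_push (inl l) (eqn_cons m t) = eqn_cons (l * m) t.
  rewrite /eqn_cons; case: eqP => [->|] //; case: t => [|[?|?] ?] //= _;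
  by rewrite mulg1.
case: s => [|[l|e] s] rs; rewrite ?[eqn_push (inl k) _]/= ?C //.
  by rewrite mulgA.
by move: rs; rewrite eqn_reduced_cons => /and3P[_]; case: s => [|[?|?] ?].
Qed.

Lemma eqn_mulw_push a s t : eqn_reduced s -> eqn_reduced t ->
  eqn_mulw (eqn_push a s) t = eqn_push a (eqn_mulw s t).
Proof.
move=> rs rt.
have C h u : eqn_mulw (eqn_cons h u) t = eqn_push (inl h) (eqn_mulw u t).
  rewrite /eqn_cons; case: eqP => [->|] //.
  have := eqn_mulw_reduced u rt; case: (eqn_mulw u t) => [|[k|e] v] //=.
  - by rewrite /eqn_cons eqxx.
  - rewrite eqn_reduced_cons mul1g /eqn_cons.
    by case/and3P=> k1 _ _; case: (k =P 1) k1 => // ->; rewrite eqxx.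
  - by rewrite /eqn_cons eqxx.
case: a s rs => [h|d] [|[k|e] s] rs //; try by rewrite [LHS]C.
  by rewrite [LHS]C -eqn_push_h // eqn_mulw_reduced.
rewrite [eqn_push _ (_ :: _)]/=.
case: ifP => // de; have -> : e = ~~ d by case: d e de {rs} => [] [].
by rewrite eqn_push_x // eqn_mulw_reduced.
Qed.

Lemma eqn_mulwA s t u : eqn_reduced t -> eqn_reduced u ->
  eqn_mulw s (eqn_mulw t u) = eqn_mulw (eqn_mulw s t) u.
Proof.
move=> rt ru; elim: s => //= a s ->.
by rewrite eqn_mulw_push // eqn_mulw_reduced.
Qed.

Lemma eqn_mulw0 s : eqn_reduced s -> eqn_mulw s [::] = s.
Proof.
elim: s => //= a s IH; rewrite eqn_reduced_cons => /and3P[a1 as_ rs].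
rewrite IH // {IH}; case: a s a1 as_ rs => [h|d] [|[k|e] s] //=;
  rewrite /eqn_cons; try by case: (h =P 1) => // ->; rewrite eqxx.
by move=> _ /negbTE->.
Qed.

Lemma eqn_invw_reduced s : eqn_reduced s -> eqn_reduced (eqn_invw s).
Proof.
rewrite /eqn_reduced /eqn_invw mem_rev rev_sorted sorted_map => /andP[s1 rs].
apply/andP; split.
  apply: contra s1 => /mapP[[h|d] // hs [/eqP]].
  by rewrite eq_sym -eqg_inv invg1 invgK => /eqP h1; rewrite -h1.
by move: rs; apply: sub_sorted => [[h|d] [k|e]] //=; rewrite !negbK => /eqP->.
Qed.

Lemma eqn_mulVw s : eqn_mulw (eqn_invw s) s = [::].
Proof.
elim: s => //= a s IH.
rewrite /eqn_invw /= rev_cons /eqn_mulw foldr_rcons.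
case: a => [h|d] /=; first by rewrite mulVg /eqn_cons eqxx.
by rewrite (_ : ~~ d != d) //; case: d.
Qed.

(* The free product of H and the infinite cyclic group generated by x, as the *)
(* set of reduced words in x, its inverse and the non-trivial elements of H.  *)
Record eqn := Eqn { eqn_val :> seq eqn_letter; eqn_valP : eqn_reduced eqn_val }.

HB.instance Definition _ := [isSub for eqn_val].
HB.instance Definition _ := [Choice of eqn by <:].

Definition eqn_one := @Eqn [::] isT.
Definition eqn_mul (s t : eqn) := Eqn (eqn_mulw_reduced s (eqn_valP t)).
Definition eqn_inv (s : eqn) := Eqn (eqn_invw_reduced (eqn_valP s)).

Lemma eqn_mulA : associative eqn_mul.
Proof. by move=> s t u; apply: val_inj; rewrite /= eqn_mulwA ?eqn_valP. Qed.
Lemma eqn_mul1 : left_id eqn_one eqn_mul.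
Proof. by move=> s; apply: val_inj. Qed.
Lemma eqn_muls1 : right_id eqn_one eqn_mul.
Proof. by move=> s; apply: val_inj; rewrite /= eqn_mulw0 ?eqn_valP. Qed.
Lemma eqn_mulV : left_inverse eqn_one eqn_inv eqn_mul.
Proof. by move=> s; apply: val_inj; rewrite /= eqn_mulVw. Qed.

HB.instance Definition _ := isGroup.Build eqn
  eqn_mulA eqn_mul1 eqn_muls1 eqn_mulV
  (left_inverse_right eqn_mulA eqn_mul1 eqn_mulV).

Lemma eqn_of_letter_subproof a : eqn_reduced (eqn_push a [::]).
Proof. exact: eqn_push_reduced. Qed.

(* The letter inl 1, which is not allowed in reduced words, denotes 1. *)
Definition eqn_of_letter a : eqn := Eqn (eqn_of_letter_subproof a).

(* Conjugating by the first letter brings the last and the first letter       *)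
(* together, where they cancel or merge.                                      *)
Definition cyclic_step (w : eqn) : eqn :=
  if eqn_val w is a :: s then
    if interact (last a s) a then w ^ eqn_of_letter a else w
  else w.

Definition cyclic_reduction (w : eqn) : eqn := iter (size w) cyclic_step w.

Definition cyclically_reduced (w : eqn) : bool :=
  if eqn_val w is a :: s then (s == [::]) || ~~ interact (last a s) a else true.

Lemma eqn_conj_first w a s : eqn_val w = a :: s ->
  eqn_val (w ^ eqn_of_letter a) = eqn_mulw s [:: a].
Proof.
move=> wE; have a1 : a != inl 1.
  by have := eqn_valP w; rewrite wE eqn_reduced_cons => /and3P[].
have ra : eqn_push a [::] = [:: a].
  by case: a a1 {wE} => [h|d] //= h1; rewrite /eqn_cons;
    case: (h =P 1) h1 => // ->; rewrite eqxx.
rewrite /conjg mulgA; congr (eqn_mulw _ _); last exact: ra.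
rewrite /= wE ra /=; case: a {wE a1 ra} => [h|d] /=.
  by rewrite mulVg /eqn_cons eqxx.
by rewrite (_ : ~~ d != d) //; case: d.
Qed.

Lemma cyclic_step_id w : cyclically_reduced w -> cyclic_step w = w.
Proof.
rewrite /cyclically_reduced /cyclic_step; case E: (eqn_val w) => [|a s] //.
case: ifP => // _; rewrite orbF => /eqP s0; apply: val_inj.
by rewrite [LHS](eqn_conj_first E) [RHS]E s0.
Qed.

Lemma cyclic_step_size w : ~~ cyclically_reduced w ->
  (size (cyclic_step w) < size w)%N.
Proof.
rewrite /cyclically_reduced /cyclic_step; case E: (eqn_val w) => [|a s] //.
rewrite negb_or negbK => /andP[s0 ab]; rewrite ab (eqn_conj_first E).
have szp b t : (size (eqn_push b t) <= (size t).+1)%N.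
  by case: b t => [h|d] [|[k|e] t] //=; rewrite /eqn_cons;
    case: ifP => //= _; rewrite ltnW.
have szm t u : (size (eqn_mulw t u) <= size t + size u)%N.
  by elim: t => //= b t IH; rewrite (leq_trans (szp _ _)).
case: (lastP s) s0 ab => // m b _;
  rewrite last_rcons [size (a :: _)]/= size_rcons => ab.
rewrite /eqn_mulw foldr_rcons ltnS (leq_trans (szm _ _)) // -addn1 leq_add2l.
by case: b a ab {E} => [h|d] [k|e] //=; rewrite /eqn_cons; case: ifP.
Qed.

Lemma cyclic_reductionP w : cyclically_reduced (cyclic_reduction w).
Proof.
suff iterP k v : cyclically_reduced v || (size v <= k)%N ->
  cyclically_reduced (iter k cyclic_step v) by apply: iterP; rewrite leqnn orbT.
elim: k v => [|k IH] v; first by rewrite leqn0 size_eq0 /cyclically_reduced /=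
  => /orP[|/eqP->].
rewrite iterSr; case: (boolP (cyclically_reduced v)) => [vc _|vn /= sv].
  by rewrite IH // cyclic_step_id ?vc.
by rewrite IH // -ltnS (leq_trans (cyclic_step_size vn)) ?orbT.
Qed.

Definition degree (w : eqn) : nat :=
  count (fun a => if a is inr _ then true else false) (cyclic_reduction w).

End Equations.

Section Ideal.
Variables (G : groupType) (S : set G) (g : G).

Definition eval_letter (a : eqn_letter (gen_group S)) : G :=
  match a with inl h => val h | inr true => g | inr false => g^-1 end.

Definition eqn_eval (w : eqn (gen_group S)) : G :=
  \prod_(a <- eqn_val w) eval_letter a.

Lemma eqn_evalM : {morph eqn_eval : u v / u * v}.
Proof.
have push a s : \prod_(b <- eqn_push a s) eval_letter b =
    eval_letter a * \prod_(b <- s) eval_letter b.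
  have C h t : \prod_(b <- eqn_cons h t) eval_letter b =
      val h * \prod_(b <- t) eval_letter b.
    rewrite /eqn_cons; case: eqP => [->|_]; last by rewrite big_cons.
    by rewrite val1 mul1g.
  case: a s => [h|d] [|[k|e] s]; rewrite /eqn_push ?C ?big_cons //.
    by rewrite valM -mulgA.
  case: ifP; rewrite ?big_cons //.
  by case: d e => [] [] //= _; rewrite mulgA ?mulgV ?mulVg mul1g.
move=> u v; rewrite /eqn_eval /=; elim: (eqn_val u) => /= [|a s IH].
  by rewrite big_nil mul1g.
by rewrite push IH big_cons mulgA.
Qed.

Lemma eqn_eval1 : eqn_eval 1 = 1.
Proof. exact: big_nil. Qed.

HB.instance Definition _ := isUMagmaMorphism.Build
  (eqn (gen_group S)) G eqn_eval (eqn_eval1, eqn_evalM).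

Definition eqn_ideal : set (eqn (gen_group S)) := [set w | eqn_eval w = 1].

Definition depends := exists2 w, eqn_ideal w & w <> 1.

Definition eqn_degrees : set nat :=
  [set d | exists w, [/\ eqn_ideal w, w <> 1 & degree w = d]].

End Ideal.

(* Algorithms are closed terms of the untyped lambda calculus with weak       *)
(* call-by-value reduction, in de Bruijn notation; data is Scott-encoded.     *)
Inductive lterm : Type :=
  | LVar of nat
  | LApp of lterm & lterm
  | LLam of lterm.

(* No lifting of u is needed: u is closed when a closed term is evaluated. *)
Fixpoint lsubst (t : lterm) (k : nat) (u : lterm) : lterm :=
  match t with
  | LVar i => if i == k then u else LVar i
  | LApp t1 t2 => LApp (lsubst t1 k u) (lsubst t2 k u)
  | LLam t1 => LLam (lsubst t1 k.+1 u)
  end.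

Inductive leval : lterm -> lterm -> Prop :=
  | LevalLam t : leval (LLam t) (LLam t)
  | LevalApp t1 t2 t u v :
      leval t1 (LLam t) -> leval t2 u -> leval (lsubst t 0%N u) v ->
      leval (LApp t1 t2) v.

Fixpoint lbound (k : nat) (t : lterm) : bool :=
  match t with
  | LVar i => (i < k)%N
  | LApp t1 t2 => lbound k t1 && lbound k t2
  | LLam t1 => lbound k.+1 t1
  end.

Definition lclosed (t : lterm) : bool := lbound 0%N t.

Definition enc_bool (b : bool) : lterm :=
  LLam (LLam (LVar (if b then 1 else 0)%N)).

Fixpoint enc_nat (m : nat) : lterm :=
  if m is m'.+1 then LLam (LLam (LApp (LVar 0%N) (enc_nat m')))
  else LLam (LLam (LVar 1%N)).

Definition enc_pair (A B : Type) (encA : A -> lterm) (encB : B -> lterm)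
    (p : A * B) : lterm :=
  LLam (LApp (LApp (LVar 0%N) (encA p.1)) (encB p.2)).

Fixpoint enc_seq (A : Type) (enc : A -> lterm) (s : seq A) : lterm :=
  if s is a :: s' then
    LLam (LLam (LApp (LApp (LVar 0%N) (enc a)) (enc_seq enc s')))
  else LLam (LLam (LVar 1%N)).

Definition enc_word (n : nat) (s : seq (letter n)) : lterm :=
  enc_seq (enc_pair (fun i : 'I_n => enc_nat i) enc_bool) s.

(* Main.v *)
Require Import Defs.
From mathcomp Require Import all_boot.
From mathcomp Require Import boolp classical_sets cardinality.
From mathcomp Require Import zify.

(* Conjugation makes a non-trivial equation of degree d cyclic: D_g consists  *)
(* of the d > 0 for which there are signs e_i and h_i in H with               *)
(* h_1 g^(e_1) ... h_d g^(e_d) = 1, where h_i <> 1 whenever e_(i-1) <> e_i    *)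
(* (indices modulo d).  The reduced words representing elements of H form a   *)
(* regular language, so such products are read by a finite automaton whose    *)
(* states also hold a counter; whether one of them is trivial is decided by   *)
(* saturating the automaton (Benois).  Counting down from d decides whether d *)
(* is in D_g, counting modulo 2 decides whether D_g contains an odd number.   *)
(* If d is in D_g then so are 2d + 2k, with k > 0, and, for d odd, 3d + 2k:   *)
(* multiply conjugates of the equation by h x^k h^-1 for suitable h in H.     *)
(* Hence finding one d of the right parity by search leaves finitely many     *)
(* degrees to test.                                                           *)

Set Implicit Arguments.
Unset Strict Implicit.
Unset Printing Implicit Defensive.

Local Open Scope nat_scope.

(** * Evaluation and computable functions *)

(** A non-trivial equation in the kernel of evaluation at g is conjugate to a cyclically reduced
    one, whose trailing coefficient can be rotated to the front. So d lies in D_g exactly when d > 0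
    and some product h_1 g^(e_1) ... h_d g^(e_d) is 1 in F_n, with h_i in H non-trivial wherever the
    sign changes, cyclically ([eqn_degreesP]).

    Whether such a product exists, for a length d in a given regular set, is a question about finite
    automata. One automaton spells the reduced words of H ([stem_reachP]). A second one spells
    coefficients and powers of g alternately, remembers signs, and moves a counter along a finite
    graph ([chain_run_sound], [chain_run_complete]). Benois' argument decides whether some word it
    reads is freely trivial: the pairs of states joined by such words are generated by empty moves,
    composition, and wrapping in a letter and its inverse ([nullP]), which is a finite computation
    ([saturateP]). By [chain_exists_degrees], two kinds of graph suffice: a path from d to 0 tests
    whether d is in D_g, and a two-cycle tests whether D_g contains an odd number.

    Finiteness of the complement comes from building new equations. F_n is torsion-free, so a
    non-trivial H has enough elements to prevent cancellation; then D_g is closed under addition,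
    and with d it contains 2(d + m) for all m > 0. If H is trivial, any degree at all forces g = 1,
    and every positive degree occurs. Hence one degree d yields all numbers from 3d + 2 on if d is
    odd, and all even ones otherwise ([large_degrees]).

    The algorithm searches for such a d, odd if an odd degree exists, and tests the finitely many
    smaller numbers. Dependence of g on H makes the search stop. Each ingredient is realised by a
    lambda term through closure properties of [computable] and through [computable_search]. *)

Section Lambda.
Implicit Types (t u v b : lterm).

Lemma lbound_leq k l t : k <= l -> Defs.lbound k t -> Defs.lbound l t.
Proof.
elim: t k l => [i|t1 IH1 t2 IH2|t IH] k l kl /=.
- by move=> ik; apply: leq_trans kl.
- by case/andP=> /(IH1 _ _ kl)-> /(IH2 _ _ kl)->.
- exact: IH.
Qed.

Lemma lsubst_bound k t u : Defs.lbound k t -> lsubst t k u = t.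
Proof.
elim: t k => [i|t1 IH1 t2 IH2|t IH] k /=.
- by case: ltngtP.
- by case/andP=> /IH1-> /IH2->.
- by move=> /IH->.
Qed.

Lemma lclosed_bound k t : lclosed t -> Defs.lbound k t.
Proof. exact: lbound_leq. Qed.

Lemma lsubst_closed k t u : lclosed t -> lsubst t k u = t.
Proof. by move=> /lclosed_bound ct; apply: lsubst_bound. Qed.

Definition value t := lclosed t && (if t is LLam _ then true else false).

Lemma value_closed t : value t -> lclosed t.
Proof. by case/andP. Qed.

Lemma leval_value v : value v -> leval v v.
Proof. by case: v => [i|t u|t] /andP[] // _ _; apply: LevalLam. Qed.

(** Evaluation read backwards: to evaluate [t] it suffices to evaluate [u]. Goals about [leval] are
    thereby rewritten under applications, with no small-step relation. *)
Definition steps t u := forall v, leval u v -> leval t v.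

Lemma steps_app1 t t' u : steps t t' -> steps (LApp t u) (LApp t' u).
Proof.
move=> tt' v E; inversion_clear E as [|? ? b w ? E1 E2 E3].
by apply: LevalApp E2 E3; apply: tt'.
Qed.

Lemma steps_app2 t u u' : steps u u' -> steps (LApp t u) (LApp t u').
Proof.
move=> uu' v E; inversion_clear E as [|? ? b w ? E1 E2 E3].
by apply: LevalApp E1 _ E3; apply: uu'.
Qed.

Lemma steps_beta b u : value u -> steps (LApp (LLam b) u) (lsubst b 0 u).
Proof. by move=> /leval_value vu v; apply: LevalApp vu; apply: LevalLam. Qed.

Lemma leval_lam t v : leval t v -> exists b, v = LLam b.
Proof. by elim=> // b; exists b. Qed.

Lemma leval_trans t u v : leval t u -> leval u v -> leval t v.
Proof.
move=> tu; have [b E] := leval_lam tu; rewrite E in tu *.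
by move=> uv; inversion uv; subst.
Qed.

Lemma steps_eval t v : leval t v -> steps t v.
Proof. by move=> tv u; apply: leval_trans. Qed.

Lemma leval_beta b u v :
  value u -> leval (lsubst b 0 u) v -> leval (LApp (LLam b) u) v.
Proof. by move=> vu; apply: steps_beta. Qed.

Lemma leval_beta1 b u x v : value u ->
  leval (LApp (lsubst b 0 u) x) v -> leval (LApp (LApp (LLam b) u) x) v.
Proof. by move=> vu; apply/steps_app1/steps_beta. Qed.

Lemma leval_beta2 b u x y v : value u ->
  leval (LApp (LApp (lsubst b 0 u) x) y) v ->
  leval (LApp (LApp (LApp (LLam b) u) x) y) v.
Proof. by move=> vu; apply/steps_app1/steps_app1/steps_beta. Qed.

End Lambda.

(** * Encoded data and the basic computable functions *)

Class enc (T : Type) :=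
  Enc { encode : T -> lterm; encode_value : forall x, value (encode x) }.

Lemma encode_closed T (eT : enc T) (x : T) : lclosed (encode x).
Proof. exact: value_closed (encode_value x). Qed.

#[local] Hint Resolve encode_value encode_closed value_closed : core.
#[local] Hint Resolve lclosed_bound : core.

Lemma bool_value b : value (enc_bool b).
Proof. by case: b. Qed.

Lemma nat_value m : value (enc_nat m).
Proof.
case: m => // m; apply/andP; split=> //.
suff: lclosed (enc_nat m) by move=> c; rewrite /lclosed /= lclosed_bound.
by elim: m => // m IH; rewrite /lclosed /= lclosed_bound.
Qed.

#[global] Instance bool_enc : enc bool := Enc bool_value.
#[global] Instance nat_enc : enc nat := Enc nat_value.

Section EncProd.
Context (A B : Type) (eA : enc A) (eB : enc B).

Lemma pair_value (p : A * B) : value (enc_pair encode encode p).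
Proof. by apply/andP; split=> //; rewrite /lclosed /= !lclosed_bound. Qed.

#[global] Instance prod_enc : enc (A * B) := Enc pair_value.

Lemma seq_value (s : seq A) : value (enc_seq encode s).
Proof.
case: s => // a s; apply/andP; split=> //.
suff: lclosed (enc_seq (@encode A eA) s) by move=> c; rewrite /lclosed /= !lclosed_bound.
by elim: s => // b s IH; rewrite /lclosed /= !lclosed_bound.
Qed.

#[global] Instance seq_enc : enc (seq A) := Enc seq_value.
End EncProd.

#[local] Hint Resolve bool_value nat_value pair_value seq_value : core.

Definition computable A B {eA : enc A} {eB : enc B} (f : A -> B) :=
  exists2 t, value t & forall a, leval (LApp t (encode a)) (encode (f a)).

Ltac closed := repeat rewrite lsubst_closed; try by auto.
Ltac valuetac :=
  by [auto | apply/andP; split; [rewrite /lclosed /= ?lclosed_bound ?lclosed_bound ?lclosed_bound; auto|]].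
Ltac beta :=
  first [ apply: leval_beta; first valuetac
        | apply: leval_beta1; first valuetac
        | apply: leval_beta2; first valuetac ];
  rewrite /=; closed.

Notation lpair :=
  (LLam (LLam (LLam (LApp (LApp (LVar 0) (LVar 2)) (LVar 1))))).

Section Primitives.
Context (A B C : Type) (eA : enc A) (eB : enc B) (eC : enc C).

Lemma computable_ext (f g : A -> B) : f =1 g -> computable f -> computable g.
Proof. by move=> fg [t vt tE]; exists t => // a; rewrite -fg. Qed.

Lemma computable_id : computable (fun x : A => x).
Proof. by exists (LLam (LVar 0)) => // a; beta; apply: leval_value. Qed.

Lemma computable_const (b : B) : computable (fun _ : A => b).
Proof.
exists (LLam (encode b)); first valuetac.
by move=> a; beta; apply: leval_value.
Qed.

Lemma computable_comp (g : B -> C) (f : A -> B) :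
  computable g -> computable f -> computable (fun x => g (f x)).
Proof.
move=> [tg vg gE] [tf vf fE]; exists (LLam (LApp tg (LApp tf (LVar 0)))).
  valuetac.
move=> a; beta; apply: (steps_app2 (steps_eval (fE a))); exact: gE.
Qed.

Lemma lpairP (a : A) (b : B) :
  leval (LApp (LApp lpair (encode a)) (encode b)) (encode (a, b)).
Proof. by beta; beta; apply: LevalLam. Qed.

Lemma computable_pair (f : A -> B) (g : A -> C) :
  computable f -> computable g -> computable (fun x => (f x, g x)).
Proof.
move=> [tf vf fE] [tg vg gE].
exists (LLam (LApp (LApp lpair (LApp tf (LVar 0))) (LApp tg (LVar 0)))).
  valuetac.
move=> a; beta.
apply: (steps_app1 (steps_app2 (steps_eval (fE a)))).
apply: (steps_app2 (steps_eval (gE a))).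
by beta; beta; apply: LevalLam.
Qed.

Lemma computable_fst0 : computable (@fst A B).
Proof.
exists (LLam (LApp (LVar 0) (LLam (LLam (LVar 1))))) => // p.
by beta; beta; beta; beta; apply: leval_value.
Qed.

Lemma computable_snd0 : computable (@snd A B).
Proof.
exists (LLam (LApp (LVar 0) (LLam (LLam (LVar 0))))) => // p.
by beta; beta; beta; beta; apply: leval_value.
Qed.

Lemma computable_if (c : A -> bool) (f g : A -> B) :
  computable c -> computable f -> computable g ->
  computable (fun x => if c x then f x else g x).
Proof.
move=> [tc vc cE] [tf vf fE] [tg vg gE].
exists (LLam (LApp (LApp (LApp tc (LVar 0)) (LApp tf (LVar 0)))
                 (LApp tg (LVar 0)))); first valuetac.
move=> a; beta.
apply: (steps_app1 (steps_app1 (steps_eval (cE a)))).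
apply: (steps_app1 (steps_app2 (steps_eval (fE a)))).
apply: (steps_app2 (steps_eval (gE a))).
by case: (c a); beta; beta; apply: leval_value.
Qed.

Lemma computable_S0 : computable S.
Proof.
exists (LLam (LLam (LLam (LApp (LVar 0) (LVar 2))))) => // m.
by beta; apply: LevalLam.
Qed.

Lemma computable_cons0 : computable (fun p : A * seq A => p.1 :: p.2).
Proof.
exists (LLam (LApp (LVar 0)
  (LLam (LLam (LLam (LLam (LApp (LApp (LVar 0) (LVar 3)) (LVar 2)))))))) => // p.
by beta; beta; beta; beta; apply: LevalLam.
Qed.

End Primitives.

(* Names a term without a body, so that simplification does not unfold it in *)
(* the self-applications R R below.                                           *)
Lemma opaque_value t : value t -> exists2 R, value R & R = t.
Proof. by exists t. Qed.

(** * Primitive recursion and unbounded search *)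

Section Recursion.
Context (A B T : Type) (eA : enc A) (eB : enc B) (eT : enc T).

Lemma computable_nat_rec0 (f : A -> B) (g : A * (nat * B) -> B) :
  computable f -> computable g ->
  computable (fun p : A * nat =>
    nat_rect (fun _ => B) (f p.1) (fun m r => g (p.1, (m, r))) p.2).
Proof.
move=> [tf vf fE] [tg vg gE].
(* R R a n dispatches on n; the branches are thunks, forced by the identity, *)
(* since call by value would otherwise evaluate the recursive call always.   *)
have [|R vR RE] := @opaque_value (LLam (LLam (LLam (LApp (LApp (LApp (LVar 0)
  (LLam (LApp tf (LVar 2))))
  (LLam (LLam (LApp tg (LApp (LApp lpair (LVar 3))
    (LApp (LApp lpair (LVar 1))
      (LApp (LApp (LApp (LVar 4) (LVar 4)) (LVar 3)) (LVar 1))))))))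
  (LLam (LVar 0)))))); first valuetac.
have [t1 v1 E1] := computable_fst0 eA nat_enc.
have [t2 v2 E2] := computable_snd0 eA nat_enc.
exists (LLam (LApp (LApp (LApp R R) (LApp t1 (LVar 0))) (LApp t2 (LVar 0)))).
  valuetac.
move=> p; beta.
apply: (steps_app1 (steps_app2 (steps_eval (E1 p)))).
apply: (steps_app2 (steps_eval (E2 p))).
case: p => a m; rewrite [fst _]/= [snd _]/=.
elim: m => [|m IH]; rewrite {1}RE; do 6!beta.
beta.
apply: (steps_app2 (steps_app2 (steps_app2 (steps_eval IH)))).
apply: (steps_app2 (steps_app2 (steps_eval (lpairP nat_enc eB m _)))).
apply: (steps_app2 (steps_eval (lpairP eA _ a (m, _)))).
exact: gE.
Qed.

Fixpoint list_rec (z : B) (s : T -> seq T -> B -> B) (l : seq T) : B :=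
  if l is x :: l' then s x l' (list_rec z s l') else z.

Lemma computable_list_rec0 (f : A -> B) (g : A * (T * (seq T * B)) -> B) :
  computable f -> computable g ->
  computable (fun p : A * seq T =>
    list_rec (f p.1) (fun x l r => g (p.1, (x, (l, r)))) p.2).
Proof.
move=> [tf vf fE] [tg vg gE].
have [|R vR RE] := @opaque_value (LLam (LLam (LLam (LApp (LApp (LApp (LVar 0)
  (LLam (LApp tf (LVar 2))))
  (LLam (LLam (LLam (LApp tg (LApp (LApp lpair (LVar 4))
    (LApp (LApp lpair (LVar 2)) (LApp (LApp lpair (LVar 1))
      (LApp (LApp (LApp (LVar 5) (LVar 5)) (LVar 4)) (LVar 1))))))))))
  (LLam (LVar 0)))))); first valuetac.
have [t1 v1 E1] := computable_fst0 eA (seq_enc eT).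
have [t2 v2 E2] := computable_snd0 eA (seq_enc eT).
exists (LLam (LApp (LApp (LApp R R) (LApp t1 (LVar 0))) (LApp t2 (LVar 0)))).
  valuetac.
move=> p; beta.
apply: (steps_app1 (steps_app2 (steps_eval (E1 p)))).
apply: (steps_app2 (steps_eval (E2 p))).
case: p => a l; rewrite [fst _]/= [snd _]/=.
elim: l => [|x l IH]; rewrite {1}RE; do 6!beta.
do 2!beta.
apply: (steps_app2 (steps_app2 (steps_app2 (steps_app2 (steps_eval IH))))).
apply: (steps_app2 (steps_app2 (steps_app2
  (steps_eval (lpairP (seq_enc eT) eB l _))))).
apply: (steps_app2 (steps_app2 (steps_eval (lpairP eT _ x (l, _))))).
apply: (steps_app2 (steps_eval (lpairP eA _ a (x, (l, _))))).
exact: gE.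
Qed.

(** Unbounded minimisation. The result is partial: evaluation is claimed only for those [a] at which
    some [k] passes the test. *)
Lemma computable_search (c : A * nat -> bool) (f : A * nat -> B) :
  computable c -> computable f ->
  exists2 t, value t & forall a, (exists k, c (a, k)) ->
    exists2 k, c (a, k) & leval (LApp t (encode a)) (encode (f (a, k))).
Proof.
move=> [tc vc cE] [tf vf fE].
(* [R R a m] tests [m], then returns [f (a, m)] or restarts at [m.+1]. Both branches are thunks, and
   only the chosen one is forced by the identity. *)
have [|R vR RE] := @opaque_value (LLam (LLam (LLam (LApp (LApp (LApp
    (LApp tc (LApp (LApp lpair (LVar 1)) (LVar 0)))
    (LLam (LApp tf (LApp (LApp lpair (LVar 2)) (LVar 1)))))
    (LLam (LApp (LApp (LApp (LVar 3) (LVar 3)) (LVar 2))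
       (LLam (LLam (LApp (LVar 0) (LVar 3)))))))
  (LLam (LVar 0)))))); first valuetac.
exists (LLam (LApp (LApp (LApp R R) (LVar 0)) (enc_nat 0))).
  valuetac.
move=> a ex_k.
have [k ck min_k] := ex_minnP ex_k.
exists k => //; beta.
have below m : m < k -> c (a, m) = false.
  by apply: contraTF => cm; rewrite -leqNgt min_k.
(* Induction on the distance [j] from the current candidate to the least witness. *)
have main j m : j + m = k ->
    leval (LApp (LApp (LApp R R) (encode a)) (enc_nat m)) (encode (f (a, k))).
  elim: j m => [|j IH] m jm; rewrite {1}RE; do 3!beta;
  apply: (steps_app1 (steps_app1 (steps_app1 (steps_app2
    (steps_eval (lpairP eA nat_enc a m))))));
  apply: (steps_app1 (steps_app1 (steps_app1 (steps_eval (cE (a, m)))))).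
    have mk : m = k by [].
    rewrite mk ck; do 3!beta.
    by apply: (steps_app2 (steps_eval (lpairP eA nat_enc a k))); apply: fE.
  rewrite below; last by rewrite -jm addSn ltnS leq_addl.
  do 3!beta; apply: (IH m.+1); by rewrite addnS.
exact: (main k 0 (addn0 k)).
Qed.
End Recursion.

Section Combinators.
Context {A B C D : Type} {eA : enc A} {eB : enc B} {eC : enc C} {eD : enc D}.

Lemma computable_app2 (F : B -> C -> D) (u : A -> B) (v : A -> C) :
  computable (fun p : B * C => F p.1 p.2) -> computable u -> computable v ->
  computable (fun x => F (u x) (v x)).
Proof.
move=> cF cu cv.
exact: (computable_comp cF (computable_pair cu cv)).
Qed.

End Combinators.

Section Constructors.
Context {A B C T : Type} {eA : enc A} {eB : enc B} {eC : enc C} {eT : enc T}.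

Lemma computable_fst (u : A -> B * C) :
  computable u -> computable (fun x => (u x).1).
Proof. by move=> cu; apply: (computable_comp (computable_fst0 eB eC) cu). Qed.

Lemma computable_snd (u : A -> B * C) :
  computable u -> computable (fun x => (u x).2).
Proof. by move=> cu; apply: (computable_comp (computable_snd0 eB eC) cu). Qed.

Lemma computable_S (u : A -> nat) :
  computable u -> computable (fun x => (u x).+1).
Proof. by move=> cu; apply: (computable_comp computable_S0 cu). Qed.

Lemma computable_cons (u : A -> T) (v : A -> seq T) :
  computable u -> computable v -> computable (fun x => u x :: v x).
Proof. exact: (computable_app2 (F := cons) (computable_cons0 eT)). Qed.

Lemma computable_nat_rec (f : A -> B) (g : A -> nat -> B -> B) (n : A -> nat) :
  computable f ->
  computable (fun p : A * (nat * B) => g p.1 p.2.1 p.2.2) ->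
  computable n ->
  computable (fun x => nat_rect (fun _ => B) (f x) (g x) (n x)).
Proof.
move=> cf cg cn.
exact: (computable_comp (computable_nat_rec0 cf cg)
          (computable_pair (computable_id eA) cn)).
Qed.

Lemma computable_list_rec (f : A -> B) (g : A -> T -> seq T -> B -> B)
    (l : A -> seq T) :
  computable f ->
  computable (fun p : A * (T * (seq T * B)) =>
    g p.1 p.2.1 p.2.2.1 p.2.2.2) ->
  computable l -> computable (fun x => list_rec (f x) (g x) (l x)).
Proof.
move=> cf cg cl.
exact: (computable_comp (computable_list_rec0 cf cg)
          (computable_pair (computable_id eA) cl)).
Qed.

Lemma computable_foldr (f : A -> B) (g : A -> T -> B -> B) (l : A -> seq T) :
  computable (fun p : A * (T * (seq T * B)) => g p.1 p.2.1 p.2.2.2) ->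
  computable f -> computable l ->
  computable (fun x => foldr (g x) (f x) (l x)).
Proof.
move=> cg cf cl; have := computable_list_rec (g := fun x t _ r => g x t r) cf cg cl.
by apply: computable_ext => x; elim: (l x) => //= t s ->.
Qed.

End Constructors.

(** * Automation, and computable functions on lists and numbers *)

Ltac computability_step := fail.
(** Descends through the body of a function, using one closure lemma per head symbol and hypotheses
    for unknown functions. The hook [computability_step] is redefined as more closure lemmas become
    available. *)
Ltac computability :=
  cbn beta iota;
  lazymatch goal with
  | |- computable (fun x => _) => idtac
  | |- computable ?f => change (computable (fun x => f x))
  end;
  lazymatch goal with
  | |- computable (fun x => x) => exact: computable_id
  | |- computable (fun _ => ?c) => exact: computable_const
  | |- computable (fun x => (@?a x, @?b x)) =>
    refine (computable_pair (f := a) (g := b) _ _); computability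
  | |- computable (fun x => fst (@?a x)) =>
    refine (computable_fst (u := a) _); computability
  | |- computable (fun x => snd (@?a x)) =>
    refine (computable_snd (u := a) _); computability
  | |- computable (fun x => S (@?a x)) =>
    refine (computable_S (u := a) _); computability
  | |- computable (fun x => @?a x :: @?b x) =>
    refine (computable_cons (u := a) (v := b) _ _); computability
  | |- computable (fun x => if _ then _ else _) =>
    apply: computable_if; computability
  | H : computable (fun p => ?f p.1 p.2) |- computable (fun x => ?f (@?a x) (@?b x)) =>
    refine (computable_app2 (F := f) (u := a) (v := b) H _ _); computability
  | H : computable (fun p => ?f p.1 p.2.1 p.2.2)
      |- computable (fun x => ?f (@?a x) (@?b x) (@?c x)) =>
    refine (computable_comp (g := fun p => f p.1 p.2.1 p.2.2)
      (f := fun x => (a x, (b x, c x))) H _); computability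
  | H : computable (fun p => ?f p.1 p.2.1 p.2.2.1 p.2.2.2)
      |- computable (fun x => ?f (@?a x) (@?b x) (@?c x) (@?d x)) =>
    refine (computable_comp (g := fun p => f p.1 p.2.1 p.2.2.1 p.2.2.2)
      (f := fun x => (a x, (b x, (c x, d x)))) H _); computability
  | H : computable ?f |- computable ?f => exact: H
  | H : computable ?f |- computable (fun x => ?f (@?a x)) =>
    refine (computable_comp (g := f) (f := a) H _); computability
  (* In the last resort, specialize a hypothesis to a function of x. *)
  | _ =>
    tryif computability_step then computability else
    first [ match goal with
            | H : computable ?g |- _ =>
              refine (computable_comp (g := g) H _); computability
            end
          | idtac ]
  end.

Section Booleans.
Context {A : Type} {eA : enc A}.

Lemma computable_andb (u v : A -> bool) :
  computable u -> computable v -> computable (fun x => u x && v x).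
Proof. by move=> cu cv; apply: computable_if; computability. Qed.

Lemma computable_orb (u v : A -> bool) :
  computable u -> computable v -> computable (fun x => u x || v x).
Proof. by move=> cu cv; apply: computable_if; computability. Qed.

Lemma computable_implb (u v : A -> bool) :
  computable u -> computable v -> computable (fun x => u x ==> v x).
Proof. by move=> cu cv; apply: computable_if; computability. Qed.

Lemma computable_negb (u : A -> bool) :
  computable u -> computable (fun x => ~~ u x).
Proof. by move=> cu; apply: computable_if; computability. Qed.

End Booleans.

Ltac computability_step ::= lazymatch goal with
  | |- computable (fun x => _ && _) => apply: computable_andb
  | |- computable (fun x => _ || _) => apply: computable_orb
  | |- computable (fun x => ~~ _) => apply: computable_negb
  | |- computable (fun x => _ ==> _) => apply: computable_implb
  end.

Generalizable Variables A B T U.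

Lemma computable_map `{eA : enc A} `{eB : enc B} `{eT : enc T}
    (f : A -> T -> B) (l : A -> seq T) :
  computable (fun p : A * T => f p.1 p.2) ->
  computable l -> computable (fun x => [seq f x t | t <- l x]).
Proof.
move=> cf cl; apply: (computable_foldr (g := fun x t r => f x t :: r));
  computability.
Qed.

Lemma computable_filter `{eA : enc A} `{eT : enc T}
    (f : A -> T -> bool) (l : A -> seq T) :
  computable (fun p : A * T => f p.1 p.2) ->
  computable l -> computable (fun x => [seq t <- l x | f x t]).
Proof.
move=> cf cl.
have: computable (fun x => foldr (fun t r => if f x t then t :: r else r)
    [::] (l x)) by apply: computable_foldr; computability.
by apply: computable_ext => x; elim: (l x) => //= t s ->.
Qed.

Lemma computable_has `{eA : enc A} `{eT : enc T}
    (f : A -> T -> bool) (l : A -> seq T) :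
  computable (fun p : A * T => f p.1 p.2) ->
  computable l -> computable (fun x => has (f x) (l x)).
Proof.
move=> cf cl.
have: computable (fun x => foldr (fun t r => f x t || r) false (l x)).
  by apply: computable_foldr; computability.
by apply: computable_ext => x; elim: (l x) => //= t s ->.
Qed.

Lemma computable_cat `{eA : enc A} `{eT : enc T} (u v : A -> seq T) :
  computable u -> computable v -> computable (fun x => u x ++ v x).
Proof.
move=> cu cv; have: computable (fun x => foldr cons (v x) (u x)).
  by apply: computable_foldr; computability.
by apply: computable_ext => x; elim: (u x) => //= t s ->.
Qed.

Lemma computable_flatten `{eA : enc A} `{eT : enc T} (u : A -> seq (seq T)) :
  computable u -> computable (fun x => flatten (u x)).
Proof.
move=> cu; apply: (computable_foldr (g := fun _ s r => s ++ r)); computability.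
by apply: computable_cat; computability.
Qed.

Lemma computable_size `{eA : enc A} `{eT : enc T} (u : A -> seq T) :
  computable u -> computable (fun x => size (u x)).
Proof.
move=> cu; have: computable (fun x => foldr (fun _ => S) 0 (u x)).
  by apply: computable_foldr; computability.
by apply: computable_ext => x; elim: (u x) => //= t s ->.
Qed.

Lemma computable_rcons `{eA : enc A} `{eT : enc T}
    (u : A -> seq T) (v : A -> T) :
  computable u -> computable v -> computable (fun x => rcons (u x) (v x)).
Proof.
move=> cu cv; have: computable (fun x => u x ++ [:: v x]).
  by apply: computable_cat; computability.
by apply: computable_ext => x; rewrite cats1.
Qed.

Lemma computable_rev `{eA : enc A} `{eT : enc T} (u : A -> seq T) :
  computable u -> computable (fun x => rev (u x)).
Proof.
move=> cu; have: computable (fun x => foldr (fun t r => rcons r t) [::] (u x)).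
  by apply: computable_foldr; computability; apply: computable_rcons;
    computability.
by apply: computable_ext => x; elim: (u x) => //= t s ->; rewrite rev_cons.
Qed.

Lemma computable_iter `{eA : enc A} `{eB : enc B}
    (f : A -> B -> B) (n : A -> nat) (b : A -> B) :
  computable (fun p : A * B => f p.1 p.2) -> computable n -> computable b ->
  computable (fun x => iter (n x) (f x) (b x)).
Proof.
move=> cf cn cb; have: computable (fun x => nat_rect (fun _ => B) (b x)
  (fun _ => f x) (n x)) by apply: computable_nat_rec; computability.
by apply: computable_ext => x; elim: (n x) => //= m ->.
Qed.

Lemma computable_allpairs `{eA : enc A} `{eB : enc B} `{eT : enc T} `{eU : enc U}
    (f : A -> T -> U -> B) (s : A -> seq T)
    (t : A -> seq U) :
  computable (fun p : A * (T * U) => f p.1 p.2.1 p.2.2) ->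
  computable s -> computable t ->
  computable (fun x => [seq f x a b | a <- s x, b <- t x]).
Proof.
move=> cf cs ct; apply: computable_flatten.
apply: (computable_map (f := fun x a => [seq f x a b | b <- t x])) => //.
apply: (computable_map (f := fun (p : A * T) b => f p.1 p.2 b)).
  by computability.
by computability.
Qed.

Lemma computable_pred `{eA : enc A} (u : A -> nat) :
  computable u -> computable (fun x => (u x).-1).
Proof.
move=> cu; have: computable (fun x => nat_rect (fun _ => nat) 0
  (fun m _ => m) (u x)) by apply: computable_nat_rec; computability.
by apply: computable_ext => x; case: (u x).
Qed.

Lemma computable_add `{eA : enc A} (u v : A -> nat) :
  computable u -> computable v -> computable (fun x => u x + v x).
Proof.
move=> cu cv; have: computable (fun x => iter (u x) S (v x)).
  by apply: computable_iter; computability.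
by apply: computable_ext => x; rewrite iter_succn addnC.
Qed.

Lemma computable_sub `{eA : enc A} (u v : A -> nat) :
  computable u -> computable v -> computable (fun x => u x - v x).
Proof.
move=> cu cv; have: computable (fun x => iter (v x) predn (u x)).
  by apply: computable_iter; computability; apply: computable_pred;
    computability.
by apply: computable_ext => x; rewrite iter_predn.
Qed.

Lemma computable_leq `{eA : enc A} (u v : A -> nat) :
  computable u -> computable v -> computable (fun x => u x <= v x).
Proof.
move=> cu cv; have: computable (fun x => nat_rect (fun _ => bool) true
  (fun _ _ => false) (u x - v x)).
  by apply: computable_nat_rec; computability; apply: computable_sub;
    computability.
by apply: computable_ext => x; rewrite /leq; case: (u x - v x).
Qed.

Lemma computable_odd `{eA : enc A}
    (u : A -> nat) :
  computable u -> computable (fun x => odd (u x)).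
Proof.
move=> cu; have: computable (fun x => nat_rect (fun _ => bool) false
  (fun _ r => ~~ r) (u x)).
  by apply: computable_nat_rec; computability; apply: computable_negb;
    computability.
by apply: computable_ext => x; elim: (u x) => //= m ->.
Qed.

Lemma computable_iota `{eA : enc A}
    (u : A -> nat) :
  computable u -> computable (fun x => iota 0 (u x)).
Proof.
move=> cu; have: computable (fun x => nat_rect (fun _ => seq nat) [::]
  (fun m r => rcons r m) (u x)).
  by apply: computable_nat_rec; computability; apply: computable_rcons;
    computability.
apply: computable_ext => x; elim: (u x) => // m IH.
by rewrite -[in RHS]addn1 iotaD -IH cats1.
Qed.

Class eq_computable (T : eqType) (eT : enc T) :=
  eq_computableP : computable (fun p : T * T => p.1 == p.2).

#[global] Instance bool_eq_computable : eq_computable bool_enc.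
Proof.
have: computable (fun p : bool * bool => if p.1 then p.2 else ~~ p.2).
  by computability; apply: computable_negb; computability.
by apply: computable_ext => -[[] []].
Qed.

#[global] Instance nat_eq_computable : eq_computable nat_enc.
Proof.
have: computable (fun p : nat * nat => (p.1 <= p.2) && (p.2 <= p.1)).
  by apply: computable_andb; apply: computable_leq; computability.
by apply: computable_ext => p; rewrite eqn_leq.
Qed.

Section EqComputable.
Context {T : eqType} {eT : enc T} {qT : eq_computable eT}.

Lemma computable_eq A {eA : enc A} (u v : A -> T) :
  computable u -> computable v -> computable (fun x => u x == v x).
Proof. exact: (computable_app2 (F := fun x y => x == y) qT). Qed.

#[global] Instance prod_eq_computable (U : eqType) (eU : enc U)
  (qU : eq_computable eU) : eq_computable (prod_enc eT eU).
Proof.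
apply: computable_andb.
  by apply: (computable_app2 (F := fun x y => x == y) qT); computability.
by apply: (computable_app2 (F := fun x y => x == y) qU); computability.
Qed.

#[global] Instance seq_eq_computable : eq_computable (seq_enc eT).
Proof.
(* Compares s with t from the right, consuming the reversal of t. *)
pose step x (r : bool * seq T) := list_rec (false, [::])
  (fun y t _ => (r.1 && (x == y), t)) r.2.
have: computable (fun p : seq T * seq T =>
    let r := foldr step (true, rev p.2) p.1 in
    r.1 && list_rec true (fun _ _ _ => false) r.2).
  have cF: computable (fun p : seq T * seq T => foldr step (true, rev p.2) p.1).
    apply: computable_foldr; computability; last by apply: computable_rev;
      computability.
    apply: computable_list_rec; computability.
    by apply: computable_eq; computability.
  apply: computable_andb; first by apply: computable_fst.
  by apply: computable_list_rec; computability.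
apply: computable_ext => -[s t] /=.
suff E b : let r := foldr step (b, rev t) s in
    r.1 && list_rec true (fun _ _ _ => false) r.2 = b && (s == t) by apply: E.
elim/last_ind: s t b => [|s x IH] t b.
  by case/lastP: t => [|t y] /=; rewrite ?rev_rcons ?andbT //=; case: t.
rewrite foldr_rcons; case/lastP: t => [|t y].
  have -> : (rcons s x == [::]) = false by apply/negbTE; case: (s).
  by rewrite andbF; apply: (IH [::] false).
rewrite rev_rcons /= IH eqseq_rcons -andbA; congr andb; exact: andbC.
Qed.

Lemma computable_mem A {eA : enc A} (u : A -> T) (v : A -> seq T) :
  computable u -> computable v -> computable (fun x => u x \in v x).
Proof.
move=> cu cv; have: computable (fun x => has (fun y => y == u x) (v x)).
  by apply: computable_has => //; apply: computable_eq; computability;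
    apply: (computable_comp cu); computability.
by apply: computable_ext => x; rewrite has_pred1.
Qed.

End EqComputable.

(** * Benois saturation *)

Section Reduction.
Variables (A : eqType) (inv : A -> A).
Hypothesis invK : involutive inv.
Implicit Types (a b : A) (s t r : seq A).

Definition reduced s := sorted (fun a b => b != inv a) s.

Definition push a s :=
  if s is b :: s' then if b == inv a then s' else a :: s else [:: a].

Definition reduce s := foldr push [::] s.

Lemma push_reduced a s : reduced s -> reduced (push a s).
Proof.
case: s => [|b s] //= bs; case: eqP => [_|/eqP ab]; first exact: path_sorted bs.
by rewrite /reduced /= ab.
Qed.

Lemma reduce_reduced s : reduced (reduce s).
Proof. by elim: s => //= a s; apply: push_reduced. Qed.

Lemma pushK a s : reduced s -> push a (push (inv a) s) = s.
Proof.
case: s => [|b s] /= bs; first by rewrite eqxx.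
rewrite invK; case: eqP => [<-|_] /=; last by rewrite eqxx.
by case: s bs => [|c s] //= /andP[/negbTE-> _].
Qed.

Lemma reduced_cons a s : reduced (a :: s) -> reduced s.
Proof. exact: path_sorted. Qed.

Lemma push_cons a s : reduced (a :: s) -> push a s = a :: s.
Proof. by case: s => [|b s] //= /andP[/negbTE-> _]. Qed.

Lemma reduce_id s : reduced s -> reduce s = s.
Proof.
elim: s => //= a s IH rs; rewrite IH ?(reduced_cons rs) //.
exact: push_cons.
Qed.

Section Automaton.
Variables (Q : Type) (edge : Q -> A -> Q -> bool) (eps : Q -> Q -> bool).
Implicit Types p q : Q.

Inductive run : Q -> seq A -> Q -> Prop :=
  | run_nil p : run p [::] p
  | run_eps p p' s q : eps p p' -> run p' s q -> run p s q
  | run_edge p a p' s q : edge p a p' -> run p' s q -> run p (a :: s) q.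

(** Benois' relation: some run from [p] to [q] reads a word that reduces to the empty word
    ([nullP]). The rules mention states and letters only, no words, so on a finite automaton they
    can be saturated. *)
Inductive null : Q -> Q -> Prop :=
  | null_refl p : null p p
  | null_eps p q : eps p q -> null p q
  | null_trans p q m : null p m -> null m q -> null p q
  | null_wrap p a p' q' q :
      edge p a p' -> null p' q' -> edge q' (inv a) q -> null p q.

(** Spells [r] letter by letter, with freely trivial detours before each letter and at the end. *)
Fixpoint reach p r q : Prop :=
  if r is b :: r' then
    exists p1 p2, [/\ null p p1, edge p1 b p2 & reach p2 r' q]
  else null p q.

Lemma run_cat p s m t q : run p s m -> run m t q -> run p (s ++ t) q.
Proof.
elim=> // [p1 p2 s1 q1 e1 _ IH|p1 a p2 s1 q1 e1 _ IH] /IH.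
  exact: run_eps e1.
exact: run_edge e1.
Qed.

Lemma reach_null p p' r q : null p p' -> reach p' r q -> reach p r q.
Proof.
case: r => [|b r] /= pp'; first exact: null_trans.
by case=> p1 [p2 [n1 e1 r1]]; exists p1, p2; split=> //; apply: null_trans n1.
Qed.

(** A letter put in front of a reduced word either stays or cancels the first letter there; in the
    second case the two letters wrap a null path. *)
Lemma run_reach p s q : run p s q -> reach p (reduce s) q.
Proof.
elim=> {p s q} [p|p p' s q e1 _|p a p' s q e1 _] /=; first exact: null_refl.
  by apply: reach_null; apply: null_eps.
case: (reduce s) => [|b r] IH; first by exists p, p'; split=> //; apply: null_refl.
rewrite /push; case: eqP => [eb|_]; last first.
  by exists p, p'; split=> //; apply: null_refl.
case: IH => p1 [p2 [n1]]; rewrite eb => e2.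
by apply: reach_null; apply: null_wrap e2; last exact: n1.
Qed.

(** The word found disappears in front of every [t], a form of triviality that composes directly in
    the induction. *)
Lemma null_run p q : null p q ->
  exists2 s, run p s q & forall t, reduce (s ++ t) = reduce t.
Proof.
elim=> {p q} [p|p q e1|p q m _ [s rs ts] _ [t rt tt]|p a p' q' q e1 _ [s rs ts] e2].
- by exists [::] => //; apply: run_nil.
- by exists [::] => //; apply: run_eps e1 _; apply: run_nil.
- by exists (s ++ t) => [|u]; [apply: run_cat rs rt|rewrite -catA ts tt].
exists (a :: s ++ [:: inv a]) => [|t].
  by apply: run_edge e1 _; apply: run_cat rs _; apply: run_edge e2 _; apply: run_nil.
by rewrite /= -catA ts /= pushK // reduce_reduced.
Qed.

Lemma reach_run p r q : reach p r q ->
  exists2 s, run p s q & forall t, reduce (s ++ t) = reduce (r ++ t).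
Proof.
elim: r p => [|b r IH] p /=; first exact: null_run.
case=> p1 [p2 [/null_run[s rs ts] e1 /IH[t rt tt]]].
exists (s ++ b :: t) => [|u].
  by apply: run_cat rs _; apply: run_edge e1 _.
by rewrite -catA ts /= tt.
Qed.

Lemma reachP p r q : reduced r ->
  reach p r q <-> exists2 s, run p s q & reduce s = r.
Proof.
move=> rr; split=> [/reach_run[s rs ts]|[s rs <-]]; last exact: run_reach.
by exists s => //; have := ts [::]; rewrite !cats0 => ->; apply: reduce_id.
Qed.

Lemma nullP p q : null p q <-> exists2 s, run p s q & reduce s = [::].
Proof. exact: (@reachP p [::] q). Qed.

End Automaton.
End Reduction.

(** * Saturation as a finite iteration *)

Section LeastFixpoint.
Variables (T : eqType) (U : seq T) (c : seq T -> T -> bool).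

Definition grow (X : seq T) := [seq u <- U | (u \in X) || c X u].
Definition lfp := iter (size U) grow [::].

Lemma lfp_ind (P : T -> Prop) :
  (forall X u, (forall v, v \in X -> P v) -> c X u -> P u) ->
  forall u, u \in lfp -> P u.
Proof.
move=> IH; rewrite /lfp; elim: (size U) => // k IHk u /=.
by rewrite mem_filter => /andP[/orP[/IHk|/(IH _ _ IHk)]].
Qed.

(** [grow] keeps what it has, so the iterates increase inside [U]. Each change adds an entry, hence
    [size U] rounds reach a fixed point. *)
Lemma lfp_closed u : u \in U -> c lfp u -> u \in lfp.
Proof.
pose F k := iter k grow [::].
have FE k : F k = [seq u <- U | u \in F k].
  case: k => [|k] /=; first by rewrite filter_pred0.
  by apply: eq_in_filter => v vU; rewrite mem_filter vU andbT.
have sub k v : v \in F k -> v \in F k.+1.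
  by rewrite [in X in X -> _]FE /= !mem_filter => /andP[-> ->].
(* Each iterate is a filter of the next one, so equal sizes force equal lists. *)
have FS k : F k = [seq u <- F k.+1 | u \in F k].
  rewrite [X in filter _ X]FE -filter_predI [LHS]FE; apply: eq_filter => v.
  apply/idP/andP=> [vF|[]] //; split; [exact: vF|exact: sub].
have stop k : F k.+1 = F k \/ k < size (F k.+1).
  elim: k => [|k IH].
    by case: (F 1) => [|v s]; [left|right].
  have [e|lt_k] := IH; first by left; apply: (congr1 grow e).
  have := count_size (mem (F k.+1)) (F k.+2).
  rewrite leq_eqVlt => /orP[|lt_c].
    by rewrite -all_count => /all_filterP e; left; rewrite [RHS]FS e.
  right; apply: leq_trans lt_c; rewrite ltnS.
  by apply: leq_trans lt_k _; rewrite [in leqLHS]FS size_filter.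
move=> uU cu; have [e|] := stop (size U).
  by rewrite /lfp -/(F _) -e /= mem_filter uU -/lfp cu orbT.
by rewrite FE size_filter ltnNge count_size.
Qed.
End LeastFixpoint.

Section Saturation.
Variables (A Q : eqType) (inv : A -> A).
Variables (edge : Q -> A -> Q -> bool) (eps : Q -> Q -> bool).
Variables (As : seq A) (Qs : seq Q).

Definition null_step (X : seq (Q * Q)) (u : Q * Q) : bool :=
  [|| u.1 == u.2, eps u.1 u.2,
      has (fun m => ((u.1, m) \in X) && ((m, u.2) \in X)) Qs |
      has (fun v => has (fun a => edge u.1 a v.1 && edge v.2 (inv a) u.2) As) X].

Definition saturate : seq (Q * Q) := lfp [seq (p, q) | p <- Qs, q <- Qs] null_step.

Hypothesis edge_closed : forall p a q,
  p \in Qs -> edge p a q -> (a \in As) && (q \in Qs).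
Hypothesis eps_closed : forall p q, p \in Qs -> eps p q -> q \in Qs.

Lemma saturate_sub u : u \in saturate -> (u.1 \in Qs) && (u.2 \in Qs).
Proof.
rewrite /saturate /lfp; case: (size _) => //= k; rewrite mem_filter.
by case/andP=> _ /allpairsP[[p q] [/= pQ qQ ->]]; rewrite pQ qQ.
Qed.

(** Since [Qs] is closed under moves, all states in a derivation of [null] from [p] stay in the
    finite table that is saturated. *)
Lemma saturateP p q :
  p \in Qs -> reflect (null inv edge eps p q) ((p, q) \in saturate).
Proof.
move=> pQ; apply: (iffP idP) => [|n].
  move=> /(lfp_ind (P := fun u => null inv edge eps u.1 u.2)); apply.
  move=> {pQ} {}X {}[{}p {}q] IH /or4P[/eqP->|e1|/hasP[m _]|/hasP[v]] /=.
  - exact: null_refl.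
  - exact: null_eps.
  - by case/andP=> /IH n1 /IH; apply: null_trans.
  - by move=> /IH n1 /hasP[a _ /andP[e1 e2]]; apply: null_wrap n1 e2.
suff: (q \in Qs) && ((p, q) \in saturate) by case/andP.
have close r t : r \in Qs -> t \in Qs -> null_step saturate (r, t) ->
    (t \in Qs) && ((r, t) \in saturate).
  move=> rQ tQ st; rewrite tQ; apply: lfp_closed st.
  by apply/allpairsP; exists (r, t).
elim: n pQ => {p q} [p|p q e1|p q m _ IH1 _ IH2|p a p' q' q e1 _ IH e2] pQ.
- by apply: close => //; rewrite /null_step eqxx.
- by apply: close (eps_closed pQ e1) _ => //; rewrite /null_step e1 orbT.
- have /andP[mQ pm] := IH1 pQ; have /andP[qQ mq] := IH2 mQ.
  apply: close => //; apply/or4P/Or43/hasP; exists m => //.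
  by rewrite pm.
have /andP[aA p'Q] := edge_closed pQ e1; have /andP[q'Q pq] := IH p'Q.
have /andP[_ qQ] := edge_closed q'Q e2.
apply: close => //; apply/or4P/Or44/hasP; exists (p', q') => //.
by apply/hasP; exists a => //; rewrite e1 e2.
Qed.

End Saturation.

(** * Products in a subgroup with prescribed shape *)

Lemma mem_pairs (S T : eqType) (s : seq S) (t : seq T) a b :
  ((a, b) \in [seq (x, y) | x <- s, y <- t]) = (a \in s) && (b \in t).
Proof.
apply/allpairsP/andP => [[[x y] [/= xs yt [-> ->]]] //|[aS bT]].
by exists (a, b).
Qed.

Section SubgroupAutomaton.
Variables (A : eqType) (inv : A -> A).
Hypothesis invK : involutive inv.
Variables (gens : seq (seq A)) (gw : bool -> seq A).
Implicit Types (a b : A) (p q s t r : seq A).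

Fixpoint suffixes s := if s is _ :: t then s :: suffixes t else [:: [::]].

(** The powers of g are listed with the generators so that [alphabet] and [stems] also serve the
    larger automaton built below. *)
Definition words := gw true :: gw false :: gens.
Definition alphabet := flatten words.
Definition stems := flatten [seq suffixes s | s <- words].

(* A state of the automaton for H is what remains to be read of a generator. *)
Definition stem_edge p a q := p == a :: q.
Definition stem_eps p q := (p == [::]) && (q \in gens).
Definition stem_null := saturate inv stem_edge stem_eps alphabet stems.

Lemma suffixesP s t : reflect (exists u, s = u ++ t) (t \in suffixes s).
Proof.
elim: s => [|a s IH] /=; rewrite inE.
  apply: (iffP eqP) => [->|[[|b u]] //]; by exists [::].
apply: (iffP orP) => [[/eqP->|/IH[u ->]]|[[|b u]] /=].
- by exists [::].
- by exists (a :: u).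
- by move=> <-; rewrite eqxx; left.
- by case=> _ su; right; apply/IH; exists u.
Qed.

Lemma stemsP p :
  reflect (exists2 s, s \in words & exists u, s = u ++ p) (p \in stems).
Proof.
apply: (iffP flatten_mapP) => [[s sw /suffixesP]|[s sw e]]; first by exists s.
by exists s => //; apply/suffixesP.
Qed.

Lemma words_stems s : s \in words -> s \in stems.
Proof. by move=> sw; apply/stemsP; exists s => //; exists [::]. Qed.

Lemma gens_stems s : s \in gens -> s \in stems.
Proof. by move=> sg; apply: words_stems; rewrite !inE sg !orbT. Qed.

Lemma gw_stems e : gw e \in stems.
Proof. by apply: words_stems; case: e; rewrite !inE eqxx ?orbT. Qed.

Lemma nil_stems : [::] \in stems.
Proof.
apply/stemsP; exists (gw true); first by rewrite inE eqxx.
by exists (gw true); rewrite cats0.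
Qed.

Lemma stems_cons a p : a :: p \in stems -> (a \in alphabet) && (p \in stems).
Proof.
case/stemsP=> s sw [u su]; apply/andP; split.
  by apply/flattenP; exists s; rewrite // su mem_cat inE eqxx orbT.
by apply/stemsP; exists s => //; exists (rcons u a); rewrite cat_rcons.
Qed.

Lemma stem_nullP p q : reflect (p \in stems /\ null inv stem_edge stem_eps p q)
  ((p, q) \in stem_null).
Proof.
have ec p' a q' : p' \in stems -> stem_edge p' a q' ->
    (a \in alphabet) && (q' \in stems).
  by move=> + /eqP E; rewrite E; apply: stems_cons.
have pc p' q' : p' \in stems -> stem_eps p' q' -> q' \in stems.
  by move=> _ /andP[_]; apply: gens_stems.
apply: (iffP idP) => [pq|[pS n]]; last exact/saturateP.
have /andP[/= pS _] := saturate_sub pq.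
by split=> //; apply/(saturateP _ ec pc).
Qed.

Lemma stem_runP p s : run stem_edge stem_eps p s [::] <->
  exists2 l, {subset l <= gens} & s = p ++ flatten l.
Proof.
split=> [|[l lg ->]].
  move E: [::] => q rs; elim: rs E => {p s q} [p|p p' s q e1 _ IH|p a p' s q e1 _ IH] E.
  - by exists [::]; rewrite // -E.
  - have [l lg ->] := IH E; case/andP: e1 => /eqP-> pg.
    by exists (p' :: l) => // x; rewrite inE => /predU1P[->|/lg].
  - by have [l lg ->] := IH E; rewrite (eqP e1); exists l.
elim: p => [|a p IH] /=; last by apply: run_edge IH; apply: eqxx.
elim: l lg => [|p l IH] lg /=; first exact: run_nil.
have pg : p \in gens by apply: lg; rewrite inE eqxx.
have {}IH : run stem_edge stem_eps [::] (flatten l) [::].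
  by apply: IH => x xl; apply: lg; rewrite inE xl orbT.
apply: (run_eps (p' := p)); first by rewrite /stem_eps eqxx.
by elim: (p) => //= a t; apply: run_edge; apply: eqxx.
Qed.

Definition in_subgroup r := exists2 l, {subset l <= gens} & reduce inv (flatten l) = r.

(** Runs from the empty stem to itself spell the unreduced products of generators; [reachP] passes
    to their normal forms. *)
Lemma stem_reachP r : reduced inv r ->
  reach inv stem_edge stem_eps [::] r [::] <-> in_subgroup r.
Proof.
move=> rr; rewrite (reachP invK _ _ _ _ rr); split=> [[s /stem_runP[l lg ->]]|[l lg <-]].
  by exists l.
by exists (flatten l) => //; apply/stem_runP; exists l.
Qed.

(** * The automaton for products of coefficients and powers of g *)

Variable next : seq (nat * nat).

(* ((k, e), (m, (l, p))): k is the counter and e the sign of the last power  *)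
(* of g; if m holds, p remains to be read of that power, otherwise a reduced  *)
(* word of H is being read, l holding its last letter and p a stem.           *)
Definition state := ((nat * bool) * (bool * (seq A * seq A)))%type.
Implicit Types (x y : state) (c : seq (seq A * bool)).

(** Inside a coefficient the automaton of H runs up to null moves, and the inverse of the last
    letter is refused. Only reduced words are spelled, so a coefficient is trivial exactly when no
    letter was read. *)
Definition chain_edge x a y := (x.1 == y.1) &&
  if x.2.1 then [&& y.2.1, y.2.2.1 == [::] & x.2.2.2 == a :: y.2.2.2]
  else [&& ~~ y.2.1, y.2.2.1 == [:: a], x.2.2.1 != [:: inv a] &
           (x.2.2.2, a :: y.2.2.2) \in stem_null].

(** A coefficient starts after a completed power of g. Once it has reached an element of H, the
    counter moves and the next sign is guessed; the sign may change only if the coefficient has read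
    a letter. *)
Definition chain_eps x y :=
  if x.2.1 then (y == (x.1, (false, ([::], [::])))) && (x.2.2.2 == [::])
  else [&& y.2.1, y.2.2.1 == [::], y.2.2.2 == gw y.1.2,
           (x.2.2.2, [::]) \in stem_null, (x.1.1, y.1.1) \in next &
           (x.1.2 != y.1.2) ==> (x.2.2.1 != [::])].

Definition rest k e : state := ((k, e), (true, ([::], [::]))).

Definition flat c := flatten [seq v.1 ++ gw v.2 | v <- c].

Fixpoint chain j f k e c : Prop :=
  if c is (r, e') :: c' then
    exists k', [/\ (k, k') \in next, reduced inv r, in_subgroup r,
                   (e != e') ==> (r != [::]) & chain j f k' e' c']
  else (k, e) = (j, f).

(** Invariant of a run. Within a power, what remains of that power is read first. Within a
    coefficient, [r] completes the word of which only the last letter [l] is kept; the conditions on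
    [l ++ r] describe the whole coefficient at its start, where [l] is empty. *)
Lemma chain_run_sound j f x s : run chain_edge chain_eps x s (rest j f) ->
  if x.2.1 then
    exists2 c, s = x.2.2.2 ++ flat c & chain j f x.1.1 x.1.2 c
  else exists k r e c, [/\ (x.1.1, k) \in next,
    s = r ++ gw e ++ flat c,
    reach inv stem_edge stem_eps x.2.2.2 r [::] /\
      (size x.2.2.1 <= 1 -> reduced inv (x.2.2.1 ++ r)),
    (x.1.2 != e) ==> (x.2.2.1 ++ r != [::]) & chain j f k e c].
Proof.
move E: (rest j f) => y rs.
elim: rs E => {x s y} [x|x x' s y e1 _ IH|x a x' s y e1 _ IH] E.
- by rewrite -E; exists [::].
- move/(_ E) in IH; move: x x' e1 IH {E} => [[k e] [m [l p]]] [[k' e'] [m' [l' p']]].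
  rewrite /chain_eps /=; case: m => [/andP[/eqP[-> -> -> -> ->]]|].
    move=> /eqP-> [k1 [r [e1 [c [kn -> [rr rd] re ch]]]]]; rewrite /= in kn ch *.
    exists ((r, e1) :: c); first by rewrite /= catA.
    have {}rd := rd isT; exists k1; split=> //; exact/stem_reachP.
  case/and5P=> /= -> _ /eqP-> n1 /andP[kn le] /= [c -> ch].
  exists k', [::], e', c; split=> //; last by rewrite cats0.
  have [_ n2] := stem_nullP _ _ n1; split=> //; rewrite cats0.
  by case: l {le} => [|? []].
- move/(_ E) in IH; move: x x' e1 IH {E} => [[k e] [m [l p]]] [[k' e'] [m' [l' p']]].
  rewrite /chain_edge /= => /andP[/eqP[<- <-]].
  case: m => [/and3P[-> _ /eqP->] [c -> ch]|]; first by exists c.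
  case/and4P=> /negbTE-> /eqP-> la n1 [k1 [r [e1 [c [kn -> [rr rd] _ ch]]]]].
  exists k1, (a :: r), e1, c; split=> //; last by apply/implyP; case: (l).
  split.
    by have [_ n2] := stem_nullP _ _ n1; exists (a :: p'), p'; split=> //; apply: eqxx.
  move=> sl; have {rd} := rd isT; case: l la sl => [|b [|? ?]] //= ba _.
  rewrite /reduced /= => ->; rewrite andbT.
  by apply: contra ba => /eqP->; rewrite invK.
Qed.

Lemma run_gw ke s t : run chain_edge chain_eps
  (ke, (true, ([::], s ++ t))) s (ke, (true, ([::], t))).
Proof.
elim: s => [|a s IH] /=; first exact: run_nil.
by apply: run_edge IH; rewrite /chain_edge /= !eqxx.
Qed.

(** The null moves in [reach] are absorbed by [stem_null], so the automaton follows [r] letter by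
    letter. *)
Lemma run_subgroup ke l p r : p \in stems ->
  reach inv stem_edge stem_eps p r [::] -> size l <= 1 -> reduced inv (l ++ r) ->
  exists l' p', [/\ run chain_edge chain_eps
      (ke, (false, (l, p))) r (ke, (false, (l', p'))),
    (p', [::]) \in stem_null & l ++ r != [::] -> l' != [::]].
Proof.
elim: r l p => [|a r IH] l p pS /=.
  move=> n _ _; exists l, p; split; [exact: run_nil| |by rewrite cats0].
  by apply/stem_nullP.
case=> p1 [p2 [n1 /eqP e1 rr]] sl lr; rewrite {}e1 in n1.
have n2 : (p, a :: p2) \in stem_null by apply/stem_nullP.
have p2S : p2 \in stems.
  by have /andP[_ /stems_cons/andP[]] := saturate_sub n2.
have rar : reduced inv ([:: a] ++ r).
  by case: l lr {sl} => // b l; rewrite /reduced /= cat_path => /andP[_ /= /andP[]].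
have [//|l' [p' [rn n3 l0]]] := IH [:: a] p2 p2S rr _ rar.
exists l', p'; split=> //; last by move=> _; apply: l0.
apply: run_edge rn; rewrite /chain_edge /= !eqxx n2 andbT /=.
case: l lr sl => // b [|//] /= /andP[ab _] _.
by apply: contra ab => /eqP[->]; rewrite invK.
Qed.

Lemma chain_run_complete j f k e c : chain j f k e c ->
  run chain_edge chain_eps (rest k e) (flat c) (rest j f).
Proof.
elim: c k e => [|[r e'] c IH] k e /=; first by case=> -> ->; apply: run_nil.
case=> k' [kn rr rg re /IH rn].
apply: (run_eps (p' := ((k, e), (false, ([::], [::]))))).
  by rewrite /chain_eps /= !eqxx.
rewrite /flat /= -catA.
have [//|l' [p' [rn2 n2 l0]]] :=
  @run_subgroup (k, e) [::] [::] r nil_stems (proj2 (stem_reachP rr) rg) _ rr.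
apply: run_cat rn2 _.
apply: (run_eps (p' := ((k', e'), (true, ([::], gw e'))))).
  rewrite /chain_eps /= !eqxx n2 kn /=.
  by apply/implyP=> /(implyP re)/l0.
apply: run_cat rn.
by have := @run_gw (k', e') (gw e') [::]; rewrite cats0.
Qed.

Definition states k :=
  [seq (ke, u) | ke <- [seq (k', e) | k' <- k :: unzip2 next, e <- [:: true; false]],
    u <- [seq (m, v) | m <- [:: true; false],
      v <- [seq (l, p) | l <- [::] :: [seq [:: a] | a <- alphabet], p <- stems]]].

Lemma mem_states k0 k e m l p : (((k, e), (m, (l, p))) \in states k0) =
  [&& k \in k0 :: unzip2 next, (l == [::]) || (l \in [seq [:: a] | a <- alphabet]) &
      p \in stems].
Proof.
rewrite !mem_pairs [l \in _]inE.
by case: e m => [] []; rewrite !inE /= ?andbT.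
Qed.

(** Beginning with the sign with which the run ends makes the sign condition cyclic. *)
Definition chain_exists i j := has (fun e =>
  (rest i e, rest j e) \in saturate inv chain_edge chain_eps alphabet (states i))
  [:: true; false].

Lemma chain_existsP i j : chain_exists i j <->
  exists e c, chain j e i e c /\ reduce inv (flat c) = [::].
Proof.
have ec x a y : x \in states i -> chain_edge x a y ->
    (a \in alphabet) && (y \in states i).
  move: x y => [[k e] [m [l p]]] [[k' e'] [m' [l' p']]].
  rewrite !mem_states /chain_edge /= => /and3P[kK _ pS] /andP[/eqP[<- _]].
  rewrite kK; case: m => [/and3P[_ -> /eqP pE]|/and4P[_ /eqP-> _ n1]].
    by move: pS; rewrite pE => /stems_cons.
  have /andP[_ /stems_cons/andP[aA ->]] := saturate_sub n1.
  by rewrite aA /= map_f.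
have pc x y : x \in states i -> chain_eps x y -> y \in states i.
  move: x y => [[k e] [m [l p]]] [[k' e'] [m' [l' p']]].
  rewrite !mem_states /chain_eps /= => /and3P[kK _ pS]; case: m.
    by case/andP=> /eqP[-> _ _ -> ->] _; rewrite kK nil_stems.
  case/and5P=> _ -> /eqP-> _ /andP[kn _]; rewrite gw_stems !andbT inE.
  by apply/orP; right; apply/mapP; exists (k, k').
have rS e : rest i e \in states i by rewrite mem_states inE eqxx nil_stems.
have dec e : reflect (exists2 c, chain j e i e c & reduce inv (flat c) = [::])
  ((rest i e, rest j e) \in saturate inv chain_edge chain_eps alphabet (states i)).
  apply: (iffP (saturateP _ ec pc _ (rS e))) => [/(nullP invK)[s]|[c ch c0]].
    by move=> /chain_run_sound /= [c -> ch] c0; exists c.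
  by apply/(nullP invK); exists (flat c) => //; apply: chain_run_complete.
split=> [/hasP[e _ /dec[c ch c0]]|[e [c [ch c0]]]]; first by exists e, c.
by apply/hasP; exists e; [case: (e)|apply/dec; exists c].
Qed.

End SubgroupAutomaton.

(** * Computability of the automata and of their saturation *)

Ltac computability_step ::= lazymatch goal with
  | |- computable (fun x => _ && _) => refine (computable_andb _ _)
  | |- computable (fun x => _ || _) => refine (computable_orb _ _)
  | |- computable (fun x => ~~ _) => refine (computable_negb _)
  | |- computable (fun x => _ ==> _) => refine (computable_implb _ _)
  | |- computable (fun x => _ == _) => refine (computable_eq _ _)
  | |- computable (fun x => _ \in _) => refine (computable_mem _ _)
  | |- computable (fun x => _ + _) => refine (computable_add _ _)
  | |- computable (fun x => odd _) => refine (computable_odd _)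
  | |- computable (fun x => iota 0 _) => refine (computable_iota _)
  | |- computable (fun x => size _) => refine (computable_size _)
  | |- computable (fun x => _ ++ _) => refine (computable_cat _ _)
  | |- computable (fun x => rev _) => refine (computable_rev _)
  | |- computable (fun x => flatten _) => refine (computable_flatten _)
  | |- computable (fun x => has _ _) => refine (computable_has _ _)
  | |- computable (fun x => filter _ _) => refine (computable_filter _ _)
  | |- computable (fun x => map _ _) => refine (computable_map _ _)
  | |- computable (fun x => allpairs_dep _ _ _) =>
    refine (computable_allpairs _ _ _)
  | |- computable (fun x => iter _ _ _) => refine (computable_iter _ _ _)
  end.

Lemma computable_saturate (X : Type) (A Q : eqType) (eX : enc X)
    (eA : enc A) (eQ : enc Q) {qA : eq_computable eA} {qQ : eq_computable eQ}
    (inv : A -> A) (edge : X -> Q -> A -> Q -> bool) (eps : X -> Q -> Q -> bool)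
    (As : X -> seq A) (Qs : X -> seq Q) :
  computable inv ->
  computable (fun p : X * (Q * (A * Q)) => edge p.1 p.2.1 p.2.2.1 p.2.2.2) ->
  computable (fun p : X * (Q * Q) => eps p.1 p.2.1 p.2.2) ->
  computable As -> computable Qs ->
  computable (fun x => saturate inv (edge x) (eps x) (As x) (Qs x)).
Proof.
move=> cinv cedge ceps cAs cQs; rewrite /saturate /lfp /grow /null_step.
computability.
Qed.

Lemma computable_suffixes (X : Type) (A : eqType) (eX : enc X) (eA : enc A)
    (u : X -> seq A) :
  computable u -> computable (fun x => suffixes (u x)).
Proof.
move=> cu; have: computable (fun x =>
  list_rec [:: [::]] (fun a t ts => (a :: t) :: ts) (u x)).
  by refine (computable_list_rec _ _ _); computability.
by apply: computable_ext => x; elim: (u x) => //= a s ->.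
Qed.

Section ChainExists.
Context (X : Type) (A : eqType) (eX : enc X) (eA : enc A).
Context (qA : eq_computable eA) (inv : A -> A) (gens : X -> seq (seq A)).
Context (gw : X -> bool -> seq A) (next : X -> seq (nat * nat)).
Context (i j : X -> nat).
Hypotheses (cinv : computable inv) (cgens : computable gens).
Hypotheses (cgw : computable (fun p : X * bool => gw p.1 p.2)).
Hypotheses (cnext : computable next) (ci : computable i) (cj : computable j).

Lemma computable_chain_exists : computable (fun x =>
  chain_exists inv (gens x) (gw x) (next x) (i x) (j x)).
Proof.
have cwords : computable (fun x => words (gens x) (gw x)).
  by rewrite /words; computability.
have cals : computable (fun x => alphabet (gens x) (gw x)).
  by rewrite /alphabet; computability.
have cstems : computable (fun x => stems (gens x) (gw x)).
  rewrite /stems; computability; refine (computable_suffixes _); computability.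
have cnull : computable (fun x => stem_null inv (gens x) (gw x)).
  refine (computable_saturate _ _ _ _ _); rewrite /stem_edge /stem_eps;
    computability.
have cedge : computable (fun p : X * (state A * (A * state A)) =>
    chain_edge inv (gens p.1) (gw p.1) p.2.1 p.2.2.1 p.2.2.2).
  by rewrite /chain_edge; computability.
have ceps : computable (fun p : X * (state A * state A) =>
    chain_eps inv (gens p.1) (gw p.1) (next p.1) p.2.1 p.2.2).
  by rewrite /chain_eps; computability.
have cstates : computable (fun x => states (gens x) (gw x) (next x) (i x)).
  have cunzip : computable (fun x => unzip2 (next x)).
    by refine (computable_map (f := fun _ v => v.2) _ _); computability.
  by rewrite /states; computability.
have csat : computable (fun x => saturate inv (chain_edge inv (gens x) (gw x))
    (chain_eps inv (gens x) (gw x) (next x)) (alphabet (gens x) (gw x))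
    (states (gens x) (gw x) (next x) (i x))).
  by refine (computable_saturate cinv cedge ceps cals cstates).
by rewrite /chain_exists /rest; computability.
Qed.
End ChainExists.

(** * Equations as cyclic words *)

Section CyclicWords.
Local Open Scope group_scope.
Variable H : groupType.
Implicit Types (h k : H) (s : seq (eqn_letter H)) (c : seq (H * bool)).

(* A list of pairs (h, e) stands for the product of the h x^e. *)
Definition compat (u v : H * bool) := (u.2 != v.2) ==> (v.1 != 1).

(* A word is the product of its segments followed by its remainder; h        *)
(* accumulates the coefficient of the next segment.                          *)
Fixpoint segs h s : seq (H * bool) :=
  match s with
  | [::] => [::]
  | inl k :: s' => segs (h * k) s'
  | inr e :: s' => (h, e) :: segs 1 s'
  end.

Fixpoint remainder h s : H :=
  match s with
  | [::] => h
  | inl k :: s' => remainder (h * k) s'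
  | inr e :: s' => remainder 1 s'
  end.

Definition is_x (a : eqn_letter H) := if a is inr _ then true else false.

Lemma size_segs h s : size (segs h s) = count is_x s.
Proof. by elim: s h => [|[k|e] s IH] h //=; rewrite IH. Qed.

Lemma segs_rcons h s e :
  segs h (rcons s (inr e)) = rcons (segs h s) (remainder h s, e).
Proof. by elim: s h => [|[k|e'] s IH] h //=; rewrite IH. Qed.

Lemma remainder_rcons h s a : remainder h (rcons s a) =
  if a is inl k then remainder h s * k else 1.
Proof. by elim: s h => [|[k|e] s IH] h //=; case: a {IH}. Qed.

Lemma remainder_x h k s : has is_x s -> remainder h s = remainder k s.
Proof. by elim: s h k => [|[l|e] s IH] h k //=; apply: IH. Qed.

(** In a reduced word a coefficient is either one non-trivial letter of H or 1 between two equal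
    letters x or x^-1. The condition on [h] provides the same for the first coefficient. *)
Lemma path_segs h s v : eqn_reduced s ->
  (if s is a :: _ then
     if a is inr e then (v.2 != e) ==> (h != 1) else h == 1 else true) ->
  path compat v (segs h s).
Proof.
elim: s h v => [|a s IH] h v //; rewrite eqn_reduced_cons => /and3P[a1 as_ rs].
case: a a1 as_ => [k|e] a1 as_ /= hv.
  rewrite (eqP hv) mul1g; apply: IH => //.
  case: s as_ {rs} => [|[l|e] s] //= _.
  by apply/implyP=> _; apply: contra a1 => /eqP->.
rewrite {1}/compat hv /=; apply: IH => //.
by case: s as_ {rs} => [|[l|e'] s] //=; rewrite ?eqxx //= negbK => ->.
Qed.

(** The remainder is rotated to the front. Cyclic reducedness excludes coefficients at both ends and
    opposite powers of x at both ends, so the first coefficient neither merges nor violates the sign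
    condition. *)
Lemma cycle_segs (w : Defs.eqn H) : cyclically_reduced w -> has is_x w ->
  cycle compat (segs (remainder 1 w) w).
Proof.
case: w => s rs; rewrite /cyclically_reduced /= => cw sx.
rewrite (cycle_path (1, true)); apply: path_segs => //.
case/lastP: s rs cw sx => // s a rs cw sx.
have la t b : last b (rcons t a) = a by rewrite last_rcons.
case: a rs cw sx la => [k|e] rs cw sx la.
  have k1 : k != 1.
    have := rs; rewrite /eqn_reduced mem_rcons inE negb_or => /andP[/andP[+ _] _].
    by apply: contra => /eqP->.
  case/lastP: s rs cw sx la => [|s [l|e]] // rs cw sx la.
    by case/andP: rs => _; rewrite -!cats1 -catA => /cat_sorted2[_].
  have -> : remainder 1 (rcons (rcons s (inr e)) (inl k)) = k.
    by rewrite !remainder_rcons mul1g.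
  case: s rs cw sx la => [|[l|e'] s] //= rs cw sx la; rewrite ?k1 ?implybT //.
  by move: cw; rewrite last_rcons; case: s {rs sx la}.
rewrite segs_rcons last_rcons remainder_rcons eqxx.
case: s rs cw sx la => [|[l|e'] s] rs /=; rewrite ?eqxx //=.
  by rewrite last_rcons; case: s {rs}.
Qed.

Definition word_of c : seq (eqn_letter H) := flatten
  [seq (if v.1 == 1 then [:: inr v.2] else [:: inl v.1; inr v.2]) | v <- c].

Lemma word_of_reduced v c : path compat v c -> eqn_reduced (inr v.2 :: word_of c).
Proof.
elim: c v => [|u c IH] v //= /andP[vu /IH].
rewrite /word_of /= -/(word_of c); move: vu; rewrite /compat.
case: (u.1 =P 1) => [_|/eqP u1] /=; rewrite ?implybF ?negbK => vu ru.
  by rewrite eqn_reduced_cons ru (eqP vu) /= eqxx.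
rewrite 2!eqn_reduced_cons ru /= !andbT.
by apply: contra u1 => /eqP[->].
Qed.

Lemma word_of_x c : count is_x (word_of c) = size c.
Proof.
elim: c => //= v c IH; rewrite /word_of /= count_cat IH.
by case: ifP.
Qed.

Lemma last_word_of v c a : last a (word_of (v :: c)) = inr (last v c).2.
Proof.
elim: c v a => [|u c IH] v a; first by rewrite /word_of /=; case: ifP.
by rewrite -cat1s /word_of map_cat flatten_cat last_cat IH.
Qed.

End CyclicWords.

(** * Degrees as lengths of trivial cyclic products *)

Section Degrees.
Local Open Scope group_scope.
Variables (G : groupType) (S : set G) (g : G).
Implicit Types (w : Defs.eqn (gen_group S)) (c : seq (gen_group S * bool)).

Definition gsign e := if e then g else g^-1.

Definition cprod c : G := \prod_(v <- c) (val v.1 * gsign v.2).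

Lemma cprod_segs (h : gen_group S) s :
  val h * \prod_(a <- s) eval_letter g a = cprod (segs h s) * val (remainder h s).
Proof.
rewrite /cprod; elim: s h => [|[k|e] s IH] h.
- by rewrite !big_nil mulg1 mul1g.
- by rewrite [segs _ _]/= [remainder _ _]/= -IH valM big_cons mulgA.
have := IH 1; rewrite val1 mul1g => IH1.
by rewrite !big_cons IH1 !mulgA; case: e.
Qed.

Lemma cprod_word_of c : \prod_(a <- word_of c) eval_letter g a = cprod c.
Proof.
rewrite /cprod /word_of; elim: c => [|[h e] c IH]; first by rewrite !big_nil.
rewrite big_cons -IH [map _ _]/= [flatten _]/= big_cat; congr (_ * _).
rewrite [(h, e).1]/= [(h, e).2]/=.
by case: (h =P 1) => [->|_]; rewrite !big_cons big_nil [LHS]/= mulg1 ?val1 ?mul1g;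
  case: e.
Qed.

Lemma eqn_eval_conj w u : eqn_eval g w = 1 -> eqn_eval g (w ^ u) = 1.
Proof.
by move=> w1; rewrite /conjg !eqn_evalM w1 mul1g -eqn_evalM mulVg eqn_eval1.
Qed.

Lemma cyclic_reduction_conj w : exists u, cyclic_reduction w = w ^ u.
Proof.
rewrite /cyclic_reduction; elim: (size w) => [|k [u /= ->]].
  by exists 1; rewrite conjg1.
rewrite /cyclic_step; case: (eqn_val _) => [|a s]; first by exists u.
case: ifP => _; last by exists u.
by exists (u * eqn_of_letter a); rewrite conjgM.
Qed.

Lemma cyclic_reduction_id w : cyclically_reduced w -> cyclic_reduction w = w.
Proof.
move=> cw; rewrite /cyclic_reduction.
by elim: (size w) => //= k ->; apply: cyclic_step_id.
Qed.

Lemma eqn_degreesP d : eqn_degrees S g d <->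
  exists c, [/\ size c = d, c != [::], cycle (@compat _) c & cprod c = 1].
Proof.
split=> [[w [w0 w1 <-]]|[c [<- c0 cc c1]]].
  have [u vE] := cyclic_reduction_conj w; rewrite /degree.
  have cv := cyclic_reductionP w; move: (cyclic_reduction w) vE cv => v vE cv.
  have v0 : eqn_eval g v = 1 by rewrite vE eqn_eval_conj.
  have v1 : v <> 1.
    by rewrite vE => /eqP; rewrite conjg_eq1 => /eqP.
  (* A reduced word without x is empty or a single letter of H, and such a letter evaluates to
     itself. *)
  have hv : has (@is_x _) v.
    apply: contra_notT v1 => nv; apply: val_inj => /=.
    case: v {vE} v0 cv nv => -[|[h|e] [|[k|e'] s]] rs //=; last first.
      by have := rs; rewrite eqn_reduced_cons andbF.
    rewrite /eqn_eval /= big_seq1 => h1 _ _.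
    have := rs; rewrite eqn_reduced_cons => /and3P[/eqP[]].
    by congr inl; apply: val_inj; rewrite val1.
  exists (segs (remainder 1 v) v); split.
  - by rewrite size_segs.
  - by rewrite -size_eq0 size_segs -lt0n -has_count.
  - exact: cycle_segs.
  (* Since [v] contains x, its remainder does not depend on the initial coefficient, so it cancels
     against the copy put in front. *)
  apply: (mulIg (val (remainder (remainder 1 v) v))); rewrite -cprod_segs.
  by rewrite -/(eqn_eval g v) v0 mulg1 mul1g; congr val; apply: remainder_x.
case: c c0 cc c1 => // v c _ cc c1.
have rw : eqn_reduced (word_of (v :: c)).
  have := cc; rewrite (cycle_path (1, true)) => /word_of_reduced.
  by rewrite eqn_reduced_cons => /and3P[].
pose w := Eqn rw; have cw : cyclically_reduced w.
  move: cc; rewrite (cycle_path (1, true)) /= /compat => /andP[vc _].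
  rewrite /cyclically_reduced [eqn_val _]/=.
  case E: (word_of (v :: c)) => [|a s] //.
  have := last_word_of v c a; rewrite E [last a (a :: s)]/= => ->.
  move: E; rewrite /word_of /=; case: (v.1 =P 1) vc => [_|_] vc [<- _].
    by move: vc; rewrite implybF negbK => /eqP->; rewrite /= eqxx orbT.
  by rewrite orbT.
exists w; split.
- by rewrite /eqn_ideal /= /eqn_eval /= cprod_word_of.
- by move=> /(congr1 (fun u : Defs.eqn _ => count (@is_x _) u)); rewrite /= word_of_x.
- by rewrite /degree cyclic_reduction_id //; exact: word_of_x.
Qed.

End Degrees.

(** * Large degrees *)

Section FreeGroupTorsion.
Local Open Scope group_scope.
Variable n : nat.
Implicit Types (a b : letter n) (s t : seq (letter n)) (u v : free_group n).

Lemma val_free_word s : val (free_word s) = free_mul s [::].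
Proof.
rewrite /free_word; elim: s => [|a s IH]; first by rewrite big_nil.
by rewrite big_cons /= -IH.
Qed.

Lemma free_wordK u : free_word (val u) = u.
Proof. by apply: val_inj; rewrite val_free_word free_muls0 // free_valP. Qed.

Lemma free_word_cat s t : free_word (s ++ t) = free_word s * free_word t.
Proof. exact: big_cat. Qed.

Lemma free_letter_inv a : free_letter (letter_inv a) = (free_letter a)^-1.
Proof. exact: val_inj. Qed.

Lemma free_mul_cat s t : free_reduced (s ++ t) -> free_mul s t = s ++ t.
Proof.
elim: s => //= a s IH rst; rewrite IH; last exact: path_sorted rst.
by case: (s ++ t) rst => [|b r] //= /andP[/negbTE->].
Qed.

(** If the last letter does not cancel the first, powers of u are plain repetitions of its word.
    Otherwise u is conjugate to a shorter word. *)
Lemma free_group_torsion_free u d : u ^+ d.+1 = 1 -> u = 1.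
Proof.
have [k] := ubnP (size (val u)); elim: k u => // k IH u.
case E: (val u) => [|a s] sz ud; first exact: val_inj.
case: (letter_inv (last a s) =P a) => [la|/eqP la]; last first.
  suff main j : val (u ^+ j) = flatten (nseq j (a :: s)).
    by have := main d.+1; rewrite ud.
  elim: j => [|j IHj] //; rewrite expgS /= IHj E free_mul_cat //.
  have := free_valP (u ^+ j); rewrite -/(val _) IHj => rj.
  have := free_valP u; rewrite -/(val _) E /free_reduced /= cat_path => -> /=.
  by case: j {IHj} rj => //= j ->; rewrite eq_sym la.
case/lastP: s => [|s b] in E sz la *.
  by case: a la {E sz} => i [].
rewrite last_rcons in la.
have bE : b = letter_inv a by rewrite -la letter_invK.
have uE : u = free_word s ^ (free_letter a)^-1.
  rewrite /conjg invgK -free_letter_inv -bE -(free_wordK u) E -cats1 -cat1s.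
  by rewrite !free_word_cat /free_word !big_seq1.
have rs : free_reduced s.
  have := free_valP u; rewrite -/(val _) E /free_reduced -cats1 -cat1s.
  by case/cat_sorted2=> _ /cat_sorted2[].
rewrite uE (IH (free_word s)) ?conj1g //.
  rewrite val_free_word free_muls0 //; move: sz; rewrite /= size_rcons => sz.
  by rewrite ltnS in sz; apply: ltnW.
by apply/eqP; rewrite -(conjg_eq1 _ (free_letter a)^-1) conjXg -uE ud.
Qed.

End FreeGroupTorsion.

Section LargeDegrees.
Local Open Scope group_scope.
Variables (n : nat) (S : set (free_group n)) (g : free_group n).
Implicit Types (h k : gen_group S) (c : seq (gen_group S * bool)).

Lemma gen_group_square h : h * h = 1 -> h = 1.
Proof.
move=> hh; apply: val_inj; rewrite val1; apply: (@free_group_torsion_free _ _ 1).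
by rewrite expgS expg1 -valM hh val1.
Qed.

(** By torsion-freeness 1, [h0] and [h0 * h0] are distinct, so one of them avoids both values. *)
Lemma gen_group_avoid (h0 k l : gen_group S) : h0 != 1 ->
  exists h, (h != k) && (h != l).
Proof.
move=> h1.
have h2 : h0 * h0 != 1 by apply: contra h1 => /eqP/gen_group_square->.
have h3 : h0 * h0 != h0 by apply: contra h1 => /eqP/(canRL (mulgK _))->; rewrite mulgV.
have [?|n1] := boolP ((1 != k) && (1 != l)); first by exists 1.
have [?|n2] := boolP ((h0 != k) && (h0 != l)); first by exists h0.
exists (h0 * h0); move: n1 n2; rewrite !negb_and !negbK.
case/orP=> /eqP E1 /orP[]/eqP E2; rewrite -?E1 -?E2 ?h2 ?h3 //.
  by rewrite E2 -E1 eqxx in h1.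
by rewrite E2 -E1 eqxx in h1.
Qed.

Lemma cycle_nseq v m : cycle (@compat (gen_group S)) (nseq m v).
Proof.
case: m => //= m; have vv : compat v v by rewrite /compat eqxx.
by elim: m => /= [|m IH]; rewrite vv.
Qed.

Definition shift h c := if c is v :: c' then (h * v.1, v.2) :: c' else [::].

(* The first coefficient is non-trivial, so nothing cancels across a junction *)
(* in front of c.                                                             *)
Definition strong c :=
  if c is v :: c' then (v.1 != 1) && path (@compat _) v c' else false.

Lemma strong_path u c : strong c -> path (@compat _) u c.
Proof.
by case: c => //= v c /andP[v1 ->]; rewrite /compat v1 implybT.
Qed.

Lemma strong_cat c c' : strong c -> strong c' -> strong (c ++ c').
Proof.
by case: c => //= v c /andP[-> pc] sc'; rewrite cat_path pc strong_path.
Qed.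

Lemma strong_cycle c : strong c -> cycle (@compat _) c.
Proof. by move=> sc; rewrite (cycle_path (1, true)) strong_path. Qed.

Lemma strong_shift h c : c != [::] -> cycle (@compat _) c ->
  h * (head (1, true) c).1 != 1 -> strong (shift h c).
Proof.
case: c => //= v c _; rewrite rcons_path => /andP[vc _] -> /=.
by case: c vc.
Qed.

Lemma size_shift h c : size (shift h c) = size c.
Proof. by case: c. Qed.

Lemma cprod_shift h c : c != [::] -> cprod g (shift h c) = val h * cprod g c.
Proof. by case: c => // v c _; rewrite /cprod !big_cons valM !mulgA. Qed.

Lemma cprod_cat c c' : cprod g (c ++ c') = cprod g c * cprod g c'.
Proof. exact: big_cat. Qed.

Lemma cprod_nseq m e : cprod g (nseq m ((1 : gen_group S), e)) = gsign g e ^+ m.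
Proof.
by rewrite /cprod big_nseq val1 mul1g; elim: m => //= m ->; rewrite expgS.
Qed.

(** The product h^-1 c h c', with h chosen so that h^-1 c_1 and h c'_1 are non-trivial: nothing
    cancels at either junction. *)
Lemma eqn_degrees_add h0 d e : h0 != 1 ->
  eqn_degrees S g d -> eqn_degrees S g e -> eqn_degrees S g (d + e).
Proof.
move=> h01 /eqn_degreesP[c [<- c0 cc c1]] /eqn_degreesP[c' [<- c'0 cc' c'1]].
have [h /andP[hk hl]] :=
  gen_group_avoid (head (1, true) c).1 ((head (1, true) c').1^-1) h01.
apply/eqn_degreesP; exists (shift h^-1 c ++ shift h c'); split.
- by rewrite size_cat !size_shift.
- by rewrite -size_eq0 size_cat !size_shift addn_eq0 size_eq0 (negbTE c0).
- apply/strong_cycle/strong_cat; apply: strong_shift => //.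
    apply: contra hk => /eqP/(congr1 (fun x => h * x)).
    by rewrite mulgA mulgV mul1g mulg1 => ->.
  apply: contra hl => /eqP/(congr1 (fun x => x * (head (1, true) c').1^-1)).
  by rewrite mulgK mul1g => ->.
- by rewrite cprod_cat !cprod_shift // c1 c'1 !mulg1 -valM mulVg val1.
Qed.

(** The product of h c h^-1 and its conjugate by x^m, namely h c h^-1 x^m h c h^-1 x^(-m), where h
    is neither 1 nor the inverse of the first coefficient of c. *)
Lemma eqn_degrees_conj h0 d m : h0 != 1 -> (0 < m)%N ->
  eqn_degrees S g d -> eqn_degrees S g ((d + m) + (d + m)).
Proof.
move=> h01 m0 /eqn_degreesP[c [<- c0 cc c1]].
have [h /andP[hk hl]] := gen_group_avoid 1 ((head (1, true) c).1^-1) h01.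
have sx e : strong (shift h^-1 (nseq m ((1 : gen_group S), e))).
  apply: strong_shift; [by case: (m) m0|exact: cycle_nseq|].
  case: (m) m0 => //= j _; rewrite mulg1; apply: contra hk => /eqP h1.
  by rewrite -(invgK h) h1 invg1.
have sc : strong (shift h c).
  apply: strong_shift => //; apply: contra hl.
  move=> /eqP/(congr1 (fun x => x * (head (1, true) c).1^-1)).
  by rewrite mulgK mul1g => ->.
apply/eqn_degreesP; exists ((shift h c ++ shift h^-1 (nseq m (1, true))) ++
  (shift h c ++ shift h^-1 (nseq m (1, false)))); split.
- by rewrite !size_cat !size_shift !size_nseq.
- by rewrite -size_eq0 !size_cat !size_shift !addn_eq0 size_eq0 (negbTE c0).
- by apply/strong_cycle/strong_cat; apply: strong_cat.
have m1 e : nseq m ((1 : gen_group S), e) != [::] by case: (m) m0.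
rewrite !cprod_cat !cprod_shift // c1 !cprod_nseq !mulg1.
have hV : val h * val h^-1 = 1 by rewrite -valM mulgV val1.
by rewrite !mulgA hV mul1g -[_ * val h * _]mulgA hV mulg1 expVgn mulgV.
Qed.

(** Over a trivial H no sign can change, so c is a non-trivial power of x. Then g has finite order,
    hence g = 1, and x^m evaluates to 1. *)
Lemma eqn_degrees_trivial d m : (forall h, h = 1) -> (0 < m)%N ->
  eqn_degrees S g d -> eqn_degrees S g m.
Proof.
move=> H1 m0 /eqn_degreesP[c [_ c0 cc c1]].
have cE e c' : path (@compat _) (1, e) c' -> c' = nseq (size c') (1, e).
  elim: c' e => //= -[h e'] c' IH e; rewrite (H1 h) => /andP[ce pc].
  move: ce pc; rewrite /compat; case: (e =P e') => [->|/eqP ee'].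
    by move=> _ /IH <-.
  by rewrite implyTb [fst _]/= (eqxx 1).
have [e {}cE] : exists e, c = nseq (size c) (1, e).
  move: cc; rewrite (cycle_path (1, true)).
  by case: (last _ _) => h e; rewrite (H1 h) => /cE; exists e.
have g1 : g = 1.
  move: c1; rewrite cE cprod_nseq; case: (size c) (size_eq0 c) => [|k _].
    by rewrite (negbTE c0).
  by move/free_group_torsion_free; case: e {cE} => // /(canRL invgK); rewrite invg1.
apply/eqn_degreesP; exists (nseq m (1, true)); split.
- exact: size_nseq.
- by case: (m) m0.
- exact: cycle_nseq.
- by rewrite cprod_nseq /= g1 expg1n.
Qed.

(** Even numbers from 2d + 2 on come from [eqn_degrees_conj]. An odd m is d plus the even number m -
    d, which must again be at least 2d + 2; this gives the bound 3d + 2. *)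
Lemma large_degrees d m : (0 < d)%N -> eqn_degrees S g d ->
  (3 * d + 2 <= m)%N -> odd m ==> odd d -> eqn_degrees S g m.
Proof.
move=> d0 dD dm odd_m.
have [[h0 h01]|H1] := pselect (exists h : gen_group S, h != 1); last first.
  apply: (eqn_degrees_trivial _ _ dD).
    by move=> h; apply/eqP; apply: contra_notT H1 => h1; exists h.
  by apply: leq_trans dm; rewrite addn2.
have even_degree j : (2 * d + 2 <= j)%N -> ~~ odd j -> eqn_degrees S g j.
  move=> dj ej; have := @eqn_degrees_conj h0 d (j./2 - d) h01 _ dD.
  have dj2 : (d < j./2)%N by rewrite -ltn_double -!muln2 mulnC; lia.
  rewrite subn_gt0 subnKC ?(ltnW dj2) // addnn even_halfK //; exact.
have [om|em] := boolP (odd m); last first.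
  by apply: even_degree em; apply: leq_trans dm; rewrite leq_add2r leq_mul2r orbT.
have {}odd_d := implyP odd_m om.
have md : (d <= m)%N by apply: leq_trans dm; rewrite mulSn -addnA leq_addr.
rewrite -(subnKC md); apply: (eqn_degrees_add h01 dD); apply: even_degree.
  by rewrite leq_subRL // addnA -mulSn.
by rewrite oddB // om odd_d.
Qed.
End LargeDegrees.

(** * The free group as words over the natural numbers *)

Section RawWords.
Local Open Scope group_scope.
Variable n : nat.
Implicit Types (a b : letter n) (s t : seq (letter n)) (u v : free_group n).

Definition raw_inv (a : nat * bool) := (a.1, ~~ a.2).

Lemma raw_invK : involutive raw_inv.
Proof. by case=> i b; rewrite /raw_inv /= negbK. Qed.

(** Forgetting the bound n puts all free groups over one alphabet, so that a single lambda term
    serves every rank; the encoding of a word does not change ([encode_raw]). *)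
Definition raw_letter a : nat * bool := (a.1 : nat, a.2).
Definition raw s := map raw_letter s.

Lemma raw_letter_inj : injective raw_letter.
Proof. by move=> [i b] [j c] [/val_inj-> ->]. Qed.

Lemma reduce_raw s : reduce raw_inv (raw s) = raw (val (free_word s)).
Proof.
rewrite val_free_word; elim: s => //= a s ->.
case: (free_mul s [::]) => //= b t.
by rewrite -[raw_inv _]/(raw_letter (letter_inv a)) (inj_eq raw_letter_inj);
  case: ifP.
Qed.

Lemma raw_nil u : (raw (val u) == [::]) = (u == 1).
Proof. by rewrite -(inj_eq val_inj) /=; case: (free_val u). Qed.

Definition word_inv (s : seq (nat * bool)) := rev (map raw_inv s).

Lemma raw_free_inv s : raw (free_inv s) = word_inv (raw s).
Proof. by rewrite /raw /free_inv /word_inv map_rev -!map_comp. Qed.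

Lemma free_word_inv s : free_word (free_inv s) = (free_word s)^-1.
Proof.
elim: s => [|a s IH]; first by rewrite /free_word big_nil invg1.
rewrite /free_inv /= rev_cons -cats1 free_word_cat -[rev _]/(free_inv s) IH.
by rewrite -[a :: s]cat1s free_word_cat invgM /free_word !big_seq1 free_letter_inv.
Qed.

Lemma free_inv_cat s t : free_inv (s ++ t) = free_inv t ++ free_inv s.
Proof. by rewrite /free_inv map_cat rev_cat. Qed.

Lemma free_invK : involutive (@free_inv n).
Proof.
by move=> s; rewrite /free_inv map_rev revK mapK //; apply: letter_invK.
Qed.

Variables (gens : seq (seq (letter n))) (w : seq (letter n)).

Definition sym_gens := gens ++ map (@free_inv n) gens.
Definition signed_word e := if e then w else free_inv w.
Local Notation S := [set` map (@free_word n) gens]%classic.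

Lemma generatedP u : (u \in generated S) <->
  exists2 l, {subset l <= sym_gens} & u = free_word (flatten l).
Proof.
split.
  pose A : set (free_group n) := [set u | exists2 l, {subset l <= sym_gens} &
    u = free_word (flatten l)]%classic.
  rewrite inE => /(_ A); apply; split.
    split=> [|u1 u2]; rewrite !inE /=.
      by exists [::]; rewrite // /free_word big_nil.
    move=> [l1 l1S ->] [l2 l2S ->].
    exists (l1 ++ rev (map (@free_inv n) l2)) => [s|].
      rewrite mem_cat mem_rev => /orP[/l1S //|/mapP[t /l2S + ->]].
      rewrite !mem_cat => /orP[tg|/mapP[t' tg ->]]; last by rewrite free_invK tg.
      by rewrite map_f ?orbT.
    rewrite flatten_cat free_word_cat; congr (_ * _); rewrite -free_word_inv.
    elim: l2 {l2S} => //= s l IH; rewrite free_inv_cat !free_word_cat IH.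
    by rewrite rev_cons flatten_rcons free_word_cat.
  move=> v /= /mapP[s sg ->]; exists [:: s]; last by rewrite /= cats0.
  by move=> x; rewrite inE => /eqP->; rewrite mem_cat sg.
case=> l lS ->; have cl := generated_closed S.
have gS s : s \in gens -> free_word s \in generated S.
  by move=> sg; rewrite inE => A [_]; apply; rewrite /= map_f.
elim: l lS => [_|s l IH lS] /=; first by rewrite /free_word big_nil; case: cl.
rewrite free_word_cat; apply: (group_closedM cl); last first.
  by apply: IH => t tl; apply: lS; rewrite inE tl orbT.
have: s \in sym_gens by apply: lS; rewrite inE eqxx.
rewrite mem_cat => /orP[/gS //|/mapP[t /gS tS ->]].
by rewrite free_word_inv; apply: (group_closedV cl).
Qed.

Definition raw_gens := map raw sym_gens.
Definition raw_sign e := raw (signed_word e).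

Lemma in_subgroupP r : in_subgroup raw_inv raw_gens r <->
  exists h : gen_group S, r = raw (val (val h)).
Proof.
split=> [[l lS <-]|[h ->]].
  have [l' l'S ->] : exists2 l', {subset l' <= sym_gens} & l = map raw l'.
    elim: l lS => [|s l IH] lS; first by exists [::].
    have [|l' l'S ->] := IH.
      by move=> t tl; apply: lS; rewrite inE tl orbT.
    have /mapP[s' s'S ->] : s \in raw_gens by apply: lS; rewrite inE eqxx.
    by exists (s' :: l') => // t; rewrite inE => /predU1P[->|/l'S].
  rewrite /raw -map_flatten -/(raw _) reduce_raw.
  have uS : free_word (flatten l') \in generated S by apply/generatedP; exists l'.
  by exists (exist (fun u => u \in generated S) _ uS).
have /generatedP[l lS hE] := valP h; exists (map raw l).
  by move=> s /mapP[t /lS tS ->]; apply: map_f.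
by rewrite /raw -map_flatten -/(raw _) reduce_raw -hE.
Qed.

Section Chains.
Variable next : seq (nat * nat).

Fixpoint npath (k m j : nat) : Prop :=
  if m is m'.+1 then exists2 k', (k, k') \in next & npath k' m' j else k = j.

Definition raw_pair (v : gen_group S * bool) := (raw (val (val v.1)), v.2).

Lemma reduced_raw u : reduced raw_inv (raw (val u)).
Proof. by rewrite -(free_wordK u) -reduce_raw reduce_reduced //; exact: raw_invK. Qed.

Lemma raw_nil1 (h : gen_group S) : (raw (val (val h)) == [::]) = (h == 1).
Proof.
by rewrite raw_nil; apply/eqP/eqP=> [h1|->]; [apply: val_inj; rewrite val1|rewrite val1].
Qed.

Lemma chain_compat j f k e c : chain raw_inv raw_gens next j f k e c <->
  exists c', [/\ c = map raw_pair c', path (@compat _) (1, e) c',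
    (last (1, e) c').2 = f & npath k (size c') j].
Proof.
(* [compat] reads only the sign of the preceding pair; the 1 in [(1, e)] is a placeholder. *)
have pE (u v : gen_group S * bool) c' : u.2 = v.2 ->
    path (@compat _) u c' = path (@compat _) v c'.
  by case: c' => //= x c' uv; rewrite /compat uv.
elim: c k e => [|[r e'] c IH] k e /=.
  split=> [[-> ->]|[[|v c'] [] //= _ _ -> -> //]]; by exists [::].
split=> [[k' [kn rr /in_subgroupP[h ->] re /IH[c' [-> pc lc nc]]]]|].
  exists ((h, e') :: c'); split=> //=.
  - rewrite (pE _ (1, e')) // pc andbT /compat /=.
    by rewrite -raw_nil1.
  - by case: c' lc {pc nc}.
  - by exists k'.
case=> -[|[h e1] c'] [] //= -[-> -> cE] /andP[ch pc] lc [k' kn nc].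
exists k'; split=> //; [exact: reduced_raw|by apply/in_subgroupP; exists h| |].
  by rewrite raw_nil1.
apply/IH; exists c'; split=> //; first by rewrite (pE _ (h, e1)).
by case: c' lc {pc nc cE}.
Qed.

Lemma flat_raw (c : seq (gen_group S * bool)) :
  reduce raw_inv (flat raw_sign (map raw_pair c)) = raw (val (cprod (free_word w) c)).
Proof.
have -> : flat raw_sign (map raw_pair c) =
    raw (flatten [seq val (val p.1) ++ signed_word p.2 | p <- c]).
  rewrite /flat /raw map_flatten -!map_comp; congr flatten; apply: eq_map => p /=.
  by rewrite map_cat.
rewrite reduce_raw; congr (raw (val _)); rewrite /cprod.
elim: c => [|[h e] c IH]; first by rewrite /free_word !big_nil.
rewrite big_cons -IH /= !free_word_cat free_wordK; congr (_ * _ * _).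
by case: e => //=; rewrite free_word_inv.
Qed.

(** The equal signs at both ends of the run give the cyclic condition of [eqn_degreesP], and
    [i != j] excludes the empty product. *)
Lemma chain_exists_degrees i j : i != j ->
  chain_exists raw_inv raw_gens raw_sign next i j <->
  exists2 d, eqn_degrees S (free_word w) d & npath i d j.
Proof.
move=> ij; rewrite (chain_existsP raw_invK).
split=> [[e [c [/chain_compat[c' [-> pc lc nc]]]]]|[d + nd]].
  move/eqP; rewrite flat_raw raw_nil => /eqP c1.
  exists (size c') => //; apply/eqn_degreesP; exists c'; split=> //.
    by apply: contraNneq ij => c0; rewrite c0 /= in nc; rewrite nc.
  rewrite (cycle_path (1, e)); case: c' pc lc {nc c1} => //= v c'.
  by rewrite /compat => + ->.
case/eqn_degreesP=> c [sc c0 cc c1].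
exists (last (1, true) c).2, (map raw_pair c); split.
  apply/chain_compat; exists c; rewrite sc; split=> //.
    move: cc; rewrite (cycle_path (1, true)).
    by case: c c0 {sc c1} => //= v c _; rewrite /compat.
  by case: c c0 {sc c1 cc}.
by apply/eqP; rewrite flat_raw raw_nil c1.
Qed.

End Chains.
End RawWords.

(** * The algorithm *)

Section Algorithm.
Notation word := (seq (nat * bool)).
Implicit Types (x : seq word * word).

Definition closed_gens x := x.1 ++ map word_inv x.1.
Definition signed x (e : bool) := if e then x.2 else word_inv x.2.

Definition has_path x next i j :=
  chain_exists raw_inv (closed_gens x) (signed x) next i j.

(** A path from d to 0 in this graph has exactly d steps. *)
Definition countdown d := [seq (k.+1, k) | k <- iota 0 d].

Definition has_degree x d := (d != 0) && has_path x (countdown d) d 0.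
(** In the two-cycle, the paths from 1 to 0 are those of odd length. *)
Definition has_odd_degree x := has_path x [:: (0, 1); (1, 0)] 1 0.

(** An odd degree is demanded whenever one exists, because [large_degrees] reaches odd numbers only
    from an odd degree. *)
Definition is_witness (p : seq word * word * nat) :=
  has_degree p.1 p.2 && (has_odd_degree p.1 ==> odd p.2).

(* Degrees from 3d + 2 on are covered by large_degrees. *)
Definition missing_degrees (p : seq word * word * nat) :=
  (has_odd_degree p.1,
   [seq m <- iota 0 (p.2 + p.2 + p.2 + 2) |
     (has_odd_degree p.1 || ~~ odd m) && ~~ has_degree p.1 m]).

Lemma computable_word_inv : computable word_inv.
Proof. by rewrite /word_inv /raw_inv; computability. Qed.

Lemma computable_has_path X {eX : enc X} (u : X -> seq word * word)
    (next : X -> seq (nat * nat)) (i j : X -> nat) :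
  computable u -> computable next -> computable i -> computable j ->
  computable (fun z => has_path (u z) (next z) (i z) (j z)).
Proof.
move=> cu cn ci cj; have cw := computable_word_inv.
apply: computable_chain_exists => //.
- by rewrite /raw_inv; computability.
- by rewrite /closed_gens; computability.
- by rewrite /signed; computability.
Qed.

Lemma computable_has_degree X {eX : enc X} (u : X -> seq word * word) (d : X -> nat) :
  computable u -> computable d -> computable (fun z => has_degree (u z) (d z)).
Proof.
move=> cu cd; have cc : computable (fun z => countdown (d z)).
  by rewrite /countdown; computability.
have := computable_has_path cu cc cd (computable_const eX nat_enc 0).
by move=> cp; rewrite /has_degree; computability.
Qed.

Lemma computable_has_odd_degree X {eX : enc X} (u : X -> seq word * word) :
  computable u -> computable (fun z => has_odd_degree (u z)).
Proof. by move=> cu; apply: computable_has_path; computability. Qed.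

Lemma computable_is_witness : computable is_witness.
Proof.
have c1 : computable (fun p : seq word * word * nat => has_degree p.1 p.2).
  by apply: computable_has_degree; computability.
have c2 : computable (fun p : seq word * word * nat => has_odd_degree p.1).
  by apply: computable_has_odd_degree; computability.
by rewrite /is_witness; computability.
Qed.

Lemma computable_missing_degrees : computable missing_degrees.
Proof.
have c1 : computable (fun p : seq word * word * nat * nat => has_degree p.1.1 p.2).
  by apply: computable_has_degree; computability.
have c2 : computable (fun p : seq word * word * nat => has_odd_degree p.1).
  by apply: computable_has_odd_degree; computability.
by rewrite /missing_degrees; computability.
Qed.

Lemma mem_countdown d k l : ((k, l) \in countdown d) = (k == l.+1) && (l < d).
Proof.
apply/mapP/andP=> [[m + [-> ->]]|[/eqP-> ld]]; first by rewrite mem_iota eqxx.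
by exists l; rewrite // mem_iota.
Qed.

Lemma npath_countdown d k m : k <= d -> npath (countdown d) k m 0 <-> m = k.
Proof.
elim: m k => [|m IH] k kd /=; first by split=> ->.
split=> [[l]|mk].
  by rewrite mem_countdown => /andP[/eqP kl ld] /(IH _ (ltnW ld))->.
rewrite -mk in kd *; exists m; first by rewrite mem_countdown eqxx.
by apply/IH => //; apply: ltnW.
Qed.

Lemma npath_parity (e : bool) m :
  npath [:: (0, 1); (1, 0)] e m 0 <-> odd m = e.
Proof.
elim: m e => [|m IH] e /=; first by case: e.
split=> [[k]|om].
  rewrite !inE => /orP[]/eqP[ee ->].
    by move/(IH true) => ->; case: e ee.
  by move/(IH false) => ->; case: e ee.
exists (~~ e); first by case: (e).
by apply/IH; rewrite -om negbK.
Qed.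

(** * Correctness of the degree tests *)

Section Correctness.
Variables (n : nat) (gens : seq (seq (letter n))) (w : seq (letter n)).
Let x := (map (@raw n) gens, raw w).
Let D := eqn_degrees [set` map (@free_word n) gens]%classic (free_word w).

Lemma has_pathP next i j : i != j ->
  has_path x next i j <-> exists2 d, D d & npath next i d j.
Proof.
move=> ij; rewrite -(chain_exists_degrees _ _ _ ij) /has_path.
have -> : closed_gens x = raw_gens gens.
  rewrite /raw_gens /sym_gens map_cat /closed_gens /= -!map_comp.
  by congr cat; apply: eq_map => s /=; rewrite raw_free_inv.
have -> // : signed x = raw_sign w.
by apply/funext=> -[] //; rewrite /raw_sign /= raw_free_inv.
Qed.

Lemma eqn_degrees_gt0 d : D d -> 0 < d.
Proof. by case/eqn_degreesP=> -[|v c] [] // <-. Qed.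

Lemma has_degreeP d : has_degree x d <-> D d.
Proof.
rewrite /has_degree; split=> [/andP[d0 /(has_pathP _ d0)[m mD]]|dD].
  by move/(npath_countdown _ (leqnn d)) => <-.
have d0 : d != 0 by rewrite -lt0n eqn_degrees_gt0.
by rewrite d0; apply/(has_pathP _ d0); exists d => //; apply/npath_countdown.
Qed.

Lemma has_odd_degreeP : has_odd_degree x <-> exists2 d, D d & odd d.
Proof.
rewrite (has_pathP _ (isT : 1 != 0)).
by split=> -[d dD dd]; exists d => //; apply/(npath_parity true).
Qed.

End Correctness.
End Algorithm.

(** * Input encodings and the complete algorithm *)

Lemma encode_raw n (s : seq (letter n)) : encode (raw s) = enc_word s.
Proof. by elim: s => //= a s; rewrite /encode /= => ->. Qed.

Lemma encode_raws n (gens : seq (seq (letter n))) :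
  encode (map (@raw n) gens) = enc_seq (@enc_word n) gens.
Proof. by elim: gens => //= s gens; rewrite /encode /= => ->; rewrite -encode_raw. Qed.

Lemma leval_uncurry t u1 u2 u3 v : value t -> value u1 -> value u2 -> value u3 ->
  leval (LApp t (LApp (LApp lpair u2) u3)) v ->
  leval (LApp (LApp (LApp (LLam (LLam (LLam
    (LApp t (LApp (LApp lpair (LVar 1)) (LVar 0)))))) u1) u2) u3) v.
Proof. by move=> vt v1 v2 v3 run; do 3!beta. Qed.

Local Open Scope classical_set_scope.

Theorem theorem4 :
  exists A : lterm, lclosed A /\
  forall (n : nat) (gens : seq (seq (letter n))) (w : seq (letter n)),
    let S : set (free_group n) := [set` map (@free_word n) gens] in
    let g : free_group n := free_word w in
    let D : set nat := eqn_degrees S g in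
    let evens : set nat := [set d | ~~ odd d] in
    let odd_case := (exists2 d, D d & odd d) /\ finite_set (~` D) in
    let even_case := D `<=` evens /\ finite_set (evens `\` D) in
    depends S g ->
    [/\ odd_case \/ even_case, ~ (odd_case /\ even_case) &
      exists (b : bool) (s : seq nat),
        leval
          (LApp (LApp (LApp A (enc_nat n)) (enc_seq (@enc_word n) gens))
                (enc_word w))
          (enc_pair enc_bool (enc_seq enc_nat) (b, s)) /\
        if b then odd_case /\ [set` s] = ~` D
        else even_case /\ [set` s] = evens `\` D].
Proof.
have [t vt tE] := computable_search computable_is_witness computable_missing_degrees.
exists (LLam (LLam (LLam (LApp t (LApp (LApp lpair (LVar 1)) (LVar 0)))))).
split; first by rewrite /lclosed /= lclosed_bound // value_closed.
move=> n gens w S g D evens odd_case even_case [v vI v1].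
pose x := (map (@raw n) gens, raw w).
have degP d : has_degree x d <-> D d := has_degreeP gens w d.
have oddP : has_odd_degree x <-> exists2 d, D d & odd d := has_odd_degreeP gens w.
(* Dependence supplies a degree, and an odd one is taken if available; this is what makes the search
   terminate. *)
have [d0 d0D odd_d0] : exists2 d, D d & has_odd_degree x ==> odd d.
  have [/oddP[d dD od]|nodd] := boolP (has_odd_degree x).
    by exists d.
  by exists (degree v) => //; exists v.
have [|k] := tE x; last rewrite {1}/is_witness /= => /andP[/degP kD odd_k] run_t.
  exists d0; apply/andP; split=> //; exact/degP.
have k0 := eqn_degrees_gt0 kD.
have large m : (k + k + k + 2 <= m)%N -> odd m ==> odd k -> D m.
  by move=> km; apply: large_degrees kD _; rewrite // !mulSn mul0n addn0 addnA.
pose s := (missing_degrees (x, k)).2.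
(* The description of [s] needs no upper bound on [m]: from 3k + 2 on both sides are false, by
   [large]. *)
have sP m : (m \in s) = (has_odd_degree x || ~~ odd m) && ~~ has_degree x m.
  rewrite /s /= mem_filter mem_iota add0n /=; case: ltnP => km; rewrite ?andbT //.
  rewrite andbF; apply/esym/negbTE; rewrite negb_and negbK -implybE.
  apply/implyP=> om; apply/degP/large => //.
  by apply/implyP=> m1; move: om; rewrite m1 orbF => /(implyP odd_k).
have out : (has_odd_degree x, s) = missing_degrees (x, k) by [].
have result : if has_odd_degree x then odd_case /\ [set` s] = ~` D
    else even_case /\ [set` s] = evens `\` D.
  case: (boolP (has_odd_degree x)) sP => [hodd|hodd] sP.
    have sE : [set` s] = ~` D.
      apply/seteqP; split=> m /=; rewrite sP /=.
        by move=> /negP nD /degP.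
      by move=> nD; apply/negP=> /degP.
    split=> //; split; first exact/oddP.
    by rewrite -sE; apply: finite_seq.
  have DE : D `<=` evens.
    move=> m mD /=; apply: contra hodd => om; apply/oddP.
    by exists m.
  have sE : [set` s] = evens `\` D.
    apply/seteqP; split=> m /=; rewrite sP /=.
      by move=> /andP[em /negP nD]; split=> // /degP.
    by case=> em nD; apply/andP; split=> //; apply/negP=> /degP.
  by split=> //; split=> //; rewrite -sE; apply: finite_seq.
split.
- by case: (has_odd_degree x) result => -[]; [left|right].
- by case=> -[[d dD od] _] [DE _]; have := DE d dD; rewrite /evens /= od.
exists (has_odd_degree x), s; split=> //.
rewrite -encode_raw -encode_raws; apply: leval_uncurry => //; try exact: encode_value.
apply: (steps_app2 (steps_eval (lpairP _ _ (map (@raw n) gens) (raw w)))).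
exact: run_t.
Qed.
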